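(* Let $U$ be a translation-invariant uniformly absolutely summable potential on $\Omega=\{-1,1\}^{\mathbb{Z}^d}$, and let $\mu^+\ne\mu^-$ be two translation-invariant Gibbs measures for $U$. Let $(S(t))_{t\ge0}$ be the Markov semigroup of a spin-flip dynamics on $\Omega$ with translation-invariant rates satisfying Condition A, and assume that this semigroup is non-degenerate. Then for all $t>0$, the measure $\mu^+S(t)$ cannot satisfy $\mathrm{GCB}(C)$ (for any constant $C>0$).
   Context: $\Omega=\{-1,1\}^{\mathbb{Z}^d}$ has the product topology and Borel $\sigma$-field; $\mathscr C(\Omega)$ is the space of real continuous functions with the supremum norm; $(\tau_i\sigma)_j=\sigma_{i+j}$; $\sigma^i$ is $\sigma$ with the spin at $i$ flipped. A function is local if it depends on finitely many coordinates. $\delta_i f=\sup_{\sigma}(f(\sigma^i)-f(\sigma))$, $\|\delta f\|_2=(\sum_{i\in\mathbb{Z}^d}(\delta_if)^2)^{1/2}\in[0,\infty]$. $\mathrm{GCB}(C)$: a probability measure $\mu$ satisfies $\mathrm{GCB}(C)$ if $\mathbb{E}_\mu(e^{f-\mathbb{E}_\mu(f)})\le e^{C\|\delta f\|_2^2}$ for all continuous $f:\Omega\to\mathbb{R}$. Potentials and Gibbs measures: let $\mathcal S$ be the set of finite subsets of $\mathbb{Z}^d$. A uniformly absolutely summable potential is a map $U:\mathcal S\times\Omega\to\mathbb{R}$ such that $U(A,\cdot)$ depends only on $\sigma_i$, $i\in A$, and $\sup_{i}\sum_{A\in\mathcal S,A\ni i}\sup_\sigma|U(A,\sigma)|<\infty$.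 It is translation invariant if $U(A+i,\sigma)=U(A,\tau_i\sigma)$ for all $A,\sigma,i$. For $\Lambda\in\mathcal S$ and $\eta\in\Omega$ put $H_\Lambda^\eta(\sigma_\Lambda)=\sum_{A\cap\Lambda\neq\emptyset}U(A,\sigma_\Lambda\eta_{\Lambda^c})$ and $\mu_\Lambda^\eta(\sigma_\Lambda)=e^{-H_\Lambda^\eta(\sigma_\Lambda)}/Z_\Lambda^\eta$, with $Z_\Lambda^\eta$ the normalizing constant. A probability measure $\mu$ is a Gibbs measure for $U$ if, for all $\Lambda\in\mathcal S$, all $\sigma$ and $\mu$-a.e. $\eta$, $\mu(\sigma_\Lambda\mid\mathcal F_{\Lambda^c})(\eta)=\mu_\Lambda^\eta(\sigma_\Lambda)$, where $\mathcal F_{\Lambda^c}$ is generated by the spins outside $\Lambda$. Dynamics: Condition A on the flip rates $c(i,\sigma)$: $\inf_{i,\sigma}c(i,\sigma)>0$ and $\sup_i\sum_{j}\sup_\sigma(c(i,\sigma^j)-c(i,\sigma))<\infty$ (the functions $c(i,\cdot)$ being continuous). Rates are translation invariant if $c(i,\sigma)=c(0,\tau_i\sigma)$. The dynamics is the Feller process whose generator is the closure in $\mathscr C(\Omega)$ of $Lf(\sigma)=\sum_ic(i,\sigma)(f(\sigma^i)-f(\sigma))$, $f$ local; $S(t)$ is its semigroup and $\mu S(t)$ is determined by $\int f\,d\mu S(t)=\int S(t)f\,d\mu$. Non-degenerate: for every pair of probability measures $\mu\ne\nu$ on $\Omega$ one has $\mu S(t)\neq\nu S(t)$ for all $t>0$.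 *)

(* Defs.v *)
From HB Require Import structures.
From mathcomp Require Import all_boot all_order all_algebra finmap.
From mathcomp Require Import all_classical all_reals all_analysis.

Set Implicit Arguments.
Unset Strict Implicit.
Unset Printing Implicit Defensive.

Import Order.TTheory GRing.Theory Num.Theory.
Import numFieldNormedType.Exports.

Local Open Scope classical_set_scope.
Local Open Scope ring_scope.

Notation site d := 'rV[int]_d.

(* Spins are encoded as booleans, [true] being +1 and [false] being -1. *)
Definition config (d : nat) : Type := {ptws site d -> bool}.

HB.instance Definition _ (d : nat) := Topological.copy (config d)
  {ptws site d -> bool}.
HB.instance Definition _ (d : nat) := isPointed.Build (config d) (fun=> true).

(* Borel sigma-field of the product topology. *)
HB.instance Definition _ (d : nat) := Measurable.copy (config d)
  (g_sigma_algebraType (@open (config d))).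

Section Configurations.
Context {d : nat}.
Implicit Types (i j : site d) (sigma eta : config d).

Definition shift i sigma : config d := fun j => sigma (i + j).

Definition flip i sigma : config d :=
  fun j => if j == i then ~~ sigma j else sigma j.

Definition agree_on (L : {fset site d}) sigma eta : Prop :=
  forall i, i \in L -> sigma i = eta i.

Definition depends_on {T : Type} (L : {fset site d}) (f : config d -> T) : Prop :=
  forall sigma eta, agree_on L sigma eta -> f sigma = f eta.

Definition is_local {T : Type} (f : config d -> T) : Prop :=
  exists L : {fset site d}, depends_on L f.

(* The configuration equal to [s] on [L] and to [eta] off [L]. *)
Definition glue (L : {fset site d}) (s : {ffun L -> bool}) eta : config d :=
  fun i => if insub i is Some x then s x else eta i.

Definition cylinder (L : {fset site d}) (s : {ffun L -> bool}) : set (config d) :=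
  [set sigma | forall x : L, sigma (val x) = s x].

Definition outside_events (L : {fset site d}) : set (set (config d)) :=
  [set B | exists i b, i \notin L /\ B = [set sigma | sigma i = b]].

End Configurations.

Section Measures.
Context {R : realType} {d : nat}.
Implicit Types mu nu : probability (config d) R.

(* A measure is a function on all sets, with unspecified values off the
   sigma-field, so that Leibniz equality would be too fine. *)
Definition same_measure mu nu : Prop :=
  forall A, measurable A -> mu A = nu A.

Definition translation_invariant mu : Prop :=
  forall i A, measurable A -> mu (shift i @^-1` A) = mu A.

Definition oscillation (i : site d) (f : config d -> R) : \bar R :=
  ereal_sup [set (f (flip i sigma) - f sigma)%:E | sigma in [set: config d]].

Definition oscillation_norm2 (f : config d -> R) : \bar R :=
  ((\esum_(i in [set: site d]) (oscillation i f ^+ 2)) `^ 2^-1)%E.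

Definition GCB mu (C : R) : Prop :=
  forall f : config d -> R, continuous f ->
    ('E_mu[fun sigma => expR (f sigma - fine 'E_mu[f])]
     <= expeR (C%:E * oscillation_norm2 f ^+ 2))%E.

End Measures.

Section Gibbs.
Context {R : realType} {d : nat}.
Variable U : {fset site d} -> config d -> R.

Definition sup_abs (f : config d -> R) : \bar R :=
  ereal_sup [set `|f sigma|%:E | sigma in [set: config d]].

Definition uas_potential : Prop :=
  (forall A, depends_on A (U A)) /\
  (ereal_sup [set \esum_(A in [set A : {fset site d} | i \in A]) sup_abs (U A)
             | i in [set: site d]] < +oo)%E.

Definition ti_potential : Prop :=
  forall (A : {fset site d}) sigma i,
    U [fset (j + i)%R | j in A]%fset sigma = U A (shift i sigma).

(* The sum defining H is absolutely convergent for the potentials considered;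
   as [esum] only sums nonnegative families, it is taken as the sum of the
   positive parts minus that of the negative parts. *)
Definition hamiltonian (L : {fset site d}) (eta : config d)
    (s : {ffun L -> bool}) : R :=
  let meets := [set A : {fset site d} | (A `&` L != fset0)%fset] in
  let V A := (U A (glue s eta))%:E in
  fine (\esum_(A in meets) V^\+ A - \esum_(A in meets) V^\- A)%E.

Definition partition_function (L : {fset site d}) (eta : config d) : R :=
  \sum_(s : {ffun L -> bool}) expR (- hamiltonian eta s).

Definition finite_volume_gibbs (L : {fset site d}) (eta : config d)
    (s : {ffun L -> bool}) : R :=
  expR (- hamiltonian eta s) / partition_function L eta.

(* [g] is a version of mu(B | <<s G >>). *)
Definition conditional_probability (mu : probability (config d) R)
    (G : set (set (config d))) (B : set (config d)) (g : config d -> R) : Prop :=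
  [/\ measurable_fun [set: g_sigma_algebraType G]
        (g : g_sigma_algebraType G -> R),
      mu.-integrable [set: config d] (EFin \o g)
    & forall A, <<s G >> A -> (\int[mu]_(eta in A) (g eta)%:E = mu (A `&` B))%E].

Definition is_gibbs (mu : probability (config d) R) : Prop :=
  forall (L : {fset site d}) (s : {ffun L -> bool}),
    exists2 g, conditional_probability mu (outside_events L) (cylinder s) g
      & {ae mu, forall eta, g eta = finite_volume_gibbs eta s}.

End Gibbs.

Section Dynamics.
Context {R : realType} {d : nat}.
Implicit Types (c : site d -> config d -> R) (f g : config d -> R).

Definition condition_A c : Prop :=
  [/\ forall i, continuous (c i),
      (0 < ereal_inf [set (c x.1 x.2)%:E | x in [set: site d * config d]])%E
    & (ereal_sup [set \esum_(j in [set: site d]) oscillation j (c i)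
                 | i in [set: site d]] < +oo)%E].

Definition ti_rates c : Prop := forall i sigma, c i sigma = c 0 (shift i sigma).

(* For local [f] the sum over Z^d has finite support. *)
Definition spin_flip_operator c f : config d -> R :=
  fun sigma => \sum_(i \in [set: site d]) c i sigma * (f (flip i sigma) - f sigma).

Local Notation unif := {uniform config d -> R}.

(* Graph of the closure of L in the supremum norm; C(Omega) is uniformly closed
   among all functions. *)
Definition spin_flip_generator c : set (unif * unif) :=
  closure [set fg : unif * unif |
    is_local (fg.1 : config d -> R) /\ fg.2 = spin_flip_operator c fg.1].

(* [S t f] is only meaningful for [0 <= t] and continuous [f]. *)
Record feller_semigroup (S : R -> (config d -> R) -> config d -> R) : Prop := {
  feller_continuous : forall t f, 0 <= t -> continuous f -> continuous (S t f);
  feller_0 : forall f, continuous f -> S 0 f = f;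
  feller_D : forall s t f, 0 <= s -> 0 <= t -> continuous f ->
    S (s + t) f = S s (S t f);
  feller_linear : forall t a f g, 0 <= t -> continuous f -> continuous g ->
    S t (fun sigma => a * f sigma + g sigma) =
    (fun sigma => a * S t f sigma + S t g sigma);
  feller_1 : forall t, 0 <= t -> S t (fun=> 1) = (fun=> 1);
  feller_ge0 : forall t f, 0 <= t -> continuous f ->
    (forall sigma, 0 <= f sigma) -> forall sigma, 0 <= S t f sigma;
  feller_strong : forall f, continuous f -> {uniform, S t f @[t --> 0^'+] --> f}
}.

Definition infinitesimal_generator (S : R -> (config d -> R) -> config d -> R) :
    set (unif * unif) :=
  [set fg : unif * unif |
    [/\ continuous (fg.1 : config d -> R), continuous (fg.2 : config d -> R)
      & {uniform, (fun sigma => t^-1 * (S t fg.1 sigma - fg.1 sigma))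
                    @[t --> 0^'+] --> (fg.2 : config d -> R)}]].

Definition spin_flip_semigroup c (S : R -> (config d -> R) -> config d -> R) :
    Prop :=
  feller_semigroup S /\ infinitesimal_generator S = spin_flip_generator c.

(* [nu] is mu S(t): by the Riesz representation theorem there is exactly one
   such measure on the Borel sigma-field. *)
Definition evolves_to (S : R -> (config d -> R) -> config d -> R) (t : R)
    (mu nu : probability (config d) R) : Prop :=
  forall f, continuous f -> ('E_nu[f] = 'E_mu[S t f])%E.

Definition nondegenerate_semigroup (S : R -> (config d -> R) -> config d -> R) : Prop :=
  forall mu nu : probability (config d) R, ~ same_measure mu nu ->
  forall t, 0 < t -> forall mut nut : probability (config d) R,
    evolves_to S t mu mut -> evolves_to S t nu nut -> ~ same_measure mut nut.

End Dynamics.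

(* Main.v *)
(** If [mup S(t)] satisfies GCB(C), apply the bound to [a F_n], where [F_n] is the
    sum of the translates of a local [f] over a cube with [N] sites; since the
    norm of [delta F_n] is [O(N^(1/2))], the centred exponential moment of
    [a F_n] under [mup S(t)] is at most [exp (O(a^2 N))]. By Jensen's inequality for
    [S(t)] this moment is at least the [mup]-mean of [exp (S(t) (a F_n - mean))],
    and [S(t) F_n] is the sum of the translates of [S(t) f], because [S(t)]
    commutes with translations. Up to [o(N)] in the exponent, [S(t) f] may be
    replaced by a local function, and then, as both measures are Gibbs for the
    same potential, [mup] by [mum]. Jensen's inequality for [mum] yields
    [mum (S(t) f) <= (mup S(t)) f + O(a)]; let [a] tend to 0, and use [- f].
    Hence [mum S(t) = mup S(t)], against non-degeneracy. *)
Require Import Defs.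
From HB Require Import structures.
From mathcomp Require Import all_boot all_order all_algebra finmap.
From mathcomp Require Import all_classical all_reals all_analysis.
From mathcomp Require Import measurable_realfun.
From mathcomp Require Import ring lra zify.

Set Implicit Arguments.
Unset Strict Implicit.
Unset Printing Implicit Defensive.

Import Order.TTheory GRing.Theory Num.Theory.
Import numFieldNormedType.Exports.

Local Open Scope classical_set_scope.
Local Open Scope ring_scope.

Local Notation shift := Defs.shift.
Local Notation glue := Defs.glue.

(** The exponential lies above its tangent at [a]. Both Jensen inequalities below, for the mean and
    for [S t], come from this bound. *)
Lemma expR_tangent {R : realType} (a x : R) : expR a * (1 - a + x) <= expR x.
Proof.
have -> : expR x = expR a * expR (x - a) by rewrite -expRD; congr expR; ring.
by rewrite ler_pM2l ?expR_gt0// (le_trans _ (expR_ge1Dx _))//; lra.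
Qed.

(** * Topology of the configuration space; uniform locality of continuous functions *)

Section Topology.
Context {R : realType} {d : nat}.
Implicit Types (i j : site d) (sigma eta : config d) (L : {fset site d}).

(** Spins are discrete, so closeness in one coordinate means equality there, and the product
    topology is tested coordinate by coordinate. *)
Lemma cvg_configP (F : set_system (config d)) sigma : Filter F ->
  F --> sigma <-> forall i, \forall eta \near F, eta i = sigma i.
Proof.
move=> FF; split=> [Fs i|Fs].
  apply: (Fs [set eta | eta i = sigma i]).
  have h := @proj_continuous (site d) (fun=> bool) i sigma.
  by have := h [set sigma i] (discrete_set1 _).
apply/cvg_sup => i U [_ [[V oV <-] /= Vs] VU]; change (F U).
by apply: filterS (Fs i) => eta e; apply: VU; rewrite /= e.
Qed.

Lemma nbhs_config L sigma : \forall eta \near sigma, agree_on L eta sigma.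
Proof.
suff: nbhs sigma [set eta | forall x, x \in enum_fset L -> eta x = sigma x].
  by apply: filterS => eta h i iL; exact: h.
have ? : Filter (nbhs sigma) := nbhs_filter sigma.
elim: (enum_fset L) => [|x s IH]; first by apply: filterE => eta x; rewrite in_nil.
have h : \forall eta \near sigma, eta x = sigma x.
  by have /cvg_configP : sigma --> sigma by []; exact.
apply: filterS2 h IH => eta e1 e2 y; rewrite in_cons => /orP[/eqP->//|].
exact: e2.
Qed.

Lemma depends_on_continuous {T : topologicalType} L (f : config d -> T) :
  depends_on L f -> continuous f.
Proof.
move=> fL sigma U; rewrite nbhs_simpl /= => /nbhs_singleton Uf.
by apply: filterS (nbhs_config L sigma) => eta h /=; rewrite (fL _ _ h).
Qed.

Lemma local_continuous {T : topologicalType} (f : config d -> T) :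
  is_local f -> continuous f.
Proof. by case=> L /depends_on_continuous. Qed.

Lemma shift_continuous i : continuous (shift i : config d -> config d).
Proof.
move=> sigma; apply/cvg_configP => j; rewrite near_map.
have := nbhs_config [fset (i + j)%R]%fset sigma.
by apply: filterS => eta /(_ (i + j)); rewrite inE eqxx => /(_ isT).
Qed.

Lemma config_compact : compact [set: config d].
Proof.
have := @tychonoff (site d) (fun=> bool) _ (fun=> bool_compact).
by congr (compact _); rewrite eqEsubset.
Qed.

Lemma continuous_bounded (f : config d -> R) : continuous f ->
  exists2 M, 0 <= M & forall sigma, `|f sigma| <= M.
Proof.
move=> cf.
have /compact_bounded[M [_ hM]] : compact (f @` [set: config d]).
  apply: continuous_compact; last exact: config_compact.
  exact: continuous_subspaceT.
exists (`|M| + 1); first by rewrite addr_ge0.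
by move=> s; apply: hM; [rewrite ltr_pwDr// ler_norm|exists s].
Qed.

(** Continuity at [sigma] gives an [n] depending on [sigma]; compactness, in its near-covering form,
    makes it uniform. *)
Lemma uniformly_local (L : nat -> {fset site d}) (f : config d -> R) (e : R) :
    (forall m n, (m <= n)%N -> L m `<=` L n)%fset ->
    (forall i, exists n, i \in L n) -> continuous f -> 0 < e ->
  exists n, forall sigma eta, agree_on (L n) sigma eta ->
    `|f sigma - f eta| < e.
Proof.
move=> mL Li cf e0.
have /compact_near_coveringP := config_compact.
move=> /(_ nat \oo (fun n sigma => forall eta, agree_on (L n) sigma eta ->
  `|f sigma - f eta| < e) _) [|n _ hn]; last first.
  by exists n => sigma eta; apply: (hn n) => //=.
move=> sigma _.
have [n hn] : exists n, forall eta, agree_on (L n) sigma eta ->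
    `|f sigma - f eta| < e / 2.
  (* As the [L n] exhaust the sites, the sets of configurations agreeing with [sigma] on [L n]
     generate a filter converging to [sigma]. *)
  pose F := filter_from setT (fun n => [set eta | agree_on (L n) sigma eta]).
  have FF : Filter F.
    apply: filter_from_filter; first by exists 0%N.
    move=> m n _ _; exists (maxn m n) => // eta h; split=> i iL; apply: h.
      by move: i iL; apply/fsubsetP/mL/leq_maxl.
    by move: i iL; apply/fsubsetP/mL/leq_maxr.
  have Fs : F --> sigma.
    apply/cvg_configP => i; have [n iL] := Li i.
    by exists n => // eta /(_ i iL).
  have : f @ F --> f sigma by apply: cvg_trans (cf sigma); exact: cvg_app Fs.
  move=> /cvgrPdist_lt /(_ _ (divr_gt0 e0 (ltr0n R 2))) [n _ hn].
  by exists n => eta; exact: hn.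
(* A configuration agreeing on a larger [L m] with a member of this neighbourhood agrees with
   [sigma] on [L n]; comparing both with [sigma] costs [e / 2] twice. *)
exists ([set eta | agree_on (L n) eta sigma], [set m | (n <= m)%N]).
  by split => /=; [exact: nbhs_config|exists n].
move=> [eta m] /= [es nm] xi ex.
have h : agree_on (L n) sigma xi.
  move=> i iL; rewrite -es//; apply: ex; move: i iL.
  exact/fsubsetP/mL.
rewrite (splitr e) (le_lt_trans (ler_distD (f sigma) _ _))// ltrD//.
- by rewrite distrC hn// => i iL; rewrite es.
- exact: hn.
Qed.

Implicit Types f g : config d -> R.

Lemma contD f g : continuous f -> continuous g -> continuous (fun s => f s + g s).
Proof. by move=> cf cg x; apply: cvgD; [exact: cf|exact: cg]. Qed.

Lemma contZ (a : R) f : continuous f -> continuous (fun s => a * f s).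
Proof. by move=> cf x; apply: cvgM; [exact: cvg_cst|exact: cf]. Qed.

Lemma contB f g : continuous f -> continuous g -> continuous (fun s => f s - g s).
Proof. by move=> cf cg x; apply: cvgB; [exact: cf|exact: cg]. Qed.

Lemma cont_cst (a : R) : continuous ((fun=> a) : config d -> R).
Proof. exact: cst_continuous. Qed.

Lemma continuous_shift f i : continuous f -> continuous (f \o shift i).
Proof.
by move=> cf x; apply: continuous_comp; [exact: shift_continuous|exact: cf].
Qed.

Lemma continuous_expR_comp f : continuous f -> continuous (expR \o f).
Proof.
by move=> cf x; apply: continuous_comp; [exact: cf|exact: continuous_expR].
Qed.

Lemma continuous_config_sum I (r : seq I) (F : I -> config d -> R) :
  (forall k, continuous (F k)) -> continuous (fun s => \sum_(k <- r) F k s).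
Proof.
move=> cF; elim: r => [|k r IH].
  by under eq_fun do rewrite big_nil; exact: cont_cst.
by under eq_fun do rewrite big_cons; exact: contD.
Qed.

End Topology.
Arguments cont_cst {R d} a _ _.
Arguments contZ {R d} a [f] _ _ _.

(** * Expectations of continuous functions *)

Section Mean.
Context {R : realType} {d : nat}.
Implicit Types (mu : probability (config d) R) (f g : config d -> R).

Definition mean mu f : R := fine 'E_mu[f]%E.

Lemma continuous_measurable f : continuous f -> measurable_fun setT f.
Proof.
move=> /continuousP cf; apply: (measurability _ (RGenOpens.measurableE R)).
move=> _ [_ [a [b ->] <-]]; rewrite setTI.
by apply: sub_sigma_algebra; exact/cf/interval_open.
Qed.

Lemma shift_measurable i : measurable_fun setT (shift i : config d -> config d).
Proof.
have cs : continuous (shift i : config d -> config d).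
  exact: shift_continuous.
move/continuousP : cs => cs.
apply: (@measurability _ _ _ _ setT _ (@open (config d))) => // _ [B oB <-].
by rewrite setTI; apply: sub_sigma_algebra; exact: cs.
Qed.

Lemma continuous_integrable mu f : continuous f ->
  mu.-integrable setT (EFin \o f).
Proof.
move=> cf; apply: measurable_bounded_integrable => //.
- by rewrite -ge0_fin_numE// fin_num_measure.
- exact: continuous_measurable.
- have [M M0 hM] := continuous_bounded cf.
  exists M; split; first exact: num_real.
  by move=> x Mx s _; apply: le_trans (hM s) (ltW Mx).
Qed.

Lemma meanE mu f : continuous f -> 'E_mu[f]%E = (mean mu f)%:E.
Proof.
move=> cf; rewrite /mean fineK// unlock integrable_fin_num//.
exact: continuous_integrable.
Qed.

Lemma mean_cst mu (a : R) : mean mu (fun=> a) = a.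
Proof. by rewrite /mean expectation_cst. Qed.

Lemma meanD mu f g : continuous f -> continuous g ->
  mean mu (fun s => f s + g s) = mean mu f + mean mu g.
Proof.
move=> cf cg; apply: EFin_inj; rewrite -meanE; last first.
  exact: contD.
rewrite EFinD -!meanE// unlock integralD_EFin//; exact: continuous_integrable.
Qed.

Lemma meanZ mu (a : R) f : continuous f ->
  mean mu (fun s => a * f s) = a * mean mu f.
Proof.
move=> cf; apply: EFin_inj; rewrite -meanE; last first.
  exact: contZ.
by rewrite EFinM -!meanE// unlock -integralZl//; exact: continuous_integrable.
Qed.

Lemma mean_sum mu I (r : seq I) (F : I -> config d -> R) :
  (forall i, continuous (F i)) ->
  mean mu (fun s => \sum_(i <- r) F i s) = \sum_(i <- r) mean mu (F i).
Proof.
move=> cF; elim: r => [|i r IH].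
  by under eq_fun do rewrite big_nil; rewrite big_nil mean_cst.
under eq_fun do rewrite big_cons.
by rewrite meanD ?IH ?big_cons//; exact: continuous_config_sum.
Qed.

Lemma le_mean mu f g : continuous f -> continuous g ->
  (forall s, f s <= g s) -> mean mu f <= mean mu g.
Proof.
move=> cf cg fg; rewrite -lee_fin -!meanE// unlock.
by apply: le_integral => //; [exact: continuous_integrable..|
  move=> s _; rewrite lee_fin].
Qed.

Lemma mean_shift mu i f : translation_invariant mu -> continuous f ->
  mean mu (f \o shift i) = mean mu f.
Proof.
move=> ti cf; rewrite /mean unlock; congr fine.
have ms := shift_measurable i.
rewrite -(@integral_pushforward _ _ _ _ _ _ ms mu setT (EFin \o f))//.
- apply: eq_measure_integral => A mA _ /=; rewrite /pushforward.
  exact: ti.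
- by apply/measurable_EFinP; exact: continuous_measurable.
- rewrite preimage_setT.
  have : continuous (f \o shift i); last exact: continuous_integrable.
  exact: continuous_shift.
Qed.

(** Jensen's inequality: the tangent at [a = mean mu f], composed with [f], has mean [expR a]. *)
Lemma le_expR_mean mu f : continuous f -> expR (mean mu f) <= mean mu (expR \o f).
Proof.
move=> cf; set a := mean mu f.
have cl : continuous (fun s => (1 - a) + f s) by apply: contD => //; exact: cont_cst.
have h : mean mu (fun s => expR a * ((1 - a) + f s)) <= mean mu (expR \o f).
  apply: le_mean; [exact: contZ|exact: continuous_expR_comp|].
  by move=> s; exact: expR_tangent.
rewrite meanZ// meanD ?mean_cst in h; [|exact: cont_cst|by []].
by move: h; rewrite subrK mulr1.
Qed.

Definition restr (L : {fset site d}) (sigma : config d) : {ffun L -> bool} :=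
  [ffun x => sigma (val x)].

Lemma glue_agree (L : {fset site d}) sigma eta :
  agree_on L (glue (restr L sigma) eta) sigma.
Proof.
by move=> i iL; rewrite /glue insubT /= ffunE.
Qed.

Lemma cylinder_open (L : {fset site d}) (s : {ffun L -> bool}) :
  open (cylinder s).
Proof.
rewrite openE => sigma /= cs; apply: filterS (nbhs_config L sigma).
by move=> eta h x; rewrite h ?cs// fsvalP.
Qed.

(** [f] is a finite combination of cylinder indicators; [eta] only fills the sites off [L], which
    [f] does not see. *)
Lemma mean_local mu (L : {fset site d}) f eta : depends_on L f ->
  mean mu f = \sum_(s : {ffun L -> bool}) f (glue s eta) * fine (mu (cylinder s)).
Proof.
move=> fL.
have mc (s : {ffun L -> bool}) : measurable (cylinder s).
  by apply: sub_sigma_algebra; exact: cylinder_open.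
have cy (s : {ffun L -> bool}) sigma : cylinder s sigma <-> s = restr L sigma.
  split => [h|-> x]; last by rewrite ffunE.
  by apply/ffunP => x; rewrite ffunE h.
pose F s sigma : R := \1_(@cylinder d L s) sigma.
have cF s : continuous (F s).
  apply: (@depends_on_continuous _ _ L) => x y xy; rewrite /F !indicE.
  have -> : (x \in cylinder s) = (y \in cylinder s); last by [].
  by apply/idP/idP => /set_mem h; apply/mem_set => z; rewrite -h;
    [rewrite xy ?fsvalP|rewrite -xy ?fsvalP].
have fE : f = (fun sigma => \sum_s f (glue s eta) * F s sigma).
  apply/funext => sigma; rewrite (bigD1 (restr L sigma))//= big1 ?addr0.
    rewrite /F indicE mem_set ?mulr1; last exact/cy.
    by apply: fL => i iL; rewrite glue_agree.
  move=> s ns; rewrite /F indicE memNset ?mulr0// => /cy sE.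
  by move: ns; rewrite sE eqxx.
rewrite {1}fE mean_sum => [|s]; last first.
  exact: contZ.
apply: eq_bigr => s _; rewrite meanZ//.
by rewrite /mean /F expectation_indic.
Qed.

End Mean.

(** * Cubes in the lattice and their relative boundary *)

Section Cubes.
Context {d : nat}.
Implicit Types (i j : site d) (m n k : nat).

(* The half-open cube [-m, k - m)^d. *)
Definition cube m k : {fset site d} :=
  [fset (\row_c ((u c : nat)%:Z - m%:Z))%R
    | u : {ffun 'I_d -> 'I_k} in {: {ffun 'I_d -> 'I_k}}]%fset.

(** Side [2m + 1] makes this the symmetric cube $[-m,m]^d$. *)
Definition ball_cube m : {fset site d} := cube m m.*2.+1.

Lemma cubeP m k i :
  reflect (forall c, - m%:Z <= i 0 c < k%:Z - m%:Z) (i \in cube m k).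
Proof.
apply: (iffP (imfsetP _ _ _ _)) => [[u _ ->] c|h].
  by rewrite mxE; case: (u c) => x /= xk; lia.
have hk c : (`|(i 0 c + m%:Z)%R| < k)%N by have := h c; lia.
exists [ffun c => Ordinal (hk c)] => //.
by apply/rowP => c; rewrite mxE ffunE /=; have := h c; lia.
Qed.

Lemma card_cube m k : #|` cube m k| = (k ^ d)%N.
Proof.
rewrite card_imfset /=.
  by rewrite -cardE card_ffun !card_ord.
move=> u v /rowP uv; apply/ffunP => c; apply: val_inj.
by have := uv c; rewrite !mxE => /addIr [].
Qed.

Lemma le_ball_cube m n : (m <= n)%N -> (ball_cube m `<=` ball_cube n)%fset.
Proof.
move=> mn; apply/fsubsetP => i /cubeP h; apply/cubeP => c.
by have := h c; lia.
Qed.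

Lemma ball_cube_cover i : exists n, i \in ball_cube n.
Proof.
exists (\max_(c < d) `|i 0%R c|%N); apply/cubeP => c.
have := @leq_bigmax _ (fun c : 'I_d => `|i 0%R c|%N) c.
by move: (i 0 c) (\max_(c0 < d) _) => x y /=; lia.
Qed.

Lemma sub_ball_cube (L : {fset site d}) : exists m, (L `<=` ball_cube m)%fset.
Proof.
exists (\max_(i : L) xchoose (ball_cube_cover (val i))).
apply/fsubsetP => i iL; have := xchooseP (ball_cube_cover (val [`iL]%fset)).
apply/fsubsetP/le_ball_cube.
exact: (@leq_bigmax L (fun i : L => xchoose (ball_cube_cover (val i))) [`iL]%fset).
Qed.

(** [cube m (n + m.*2)] is $[-m,n+m)^d$, the window $[0,n)^d$ thickened by [m] on every side. *)
Lemma add_ball_cube m n i j : i \in cube 0 n -> j \in ball_cube m ->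
  i + j \in cube m (n + m.*2).
Proof.
move=> /cubeP hi /cubeP hj; apply/cubeP => c.
by rewrite mxE; move: (hi c) (hj c); move: (i 0 c) (j 0 c) => x y; lia.
Qed.

End Cubes.

(** The ratio of the two volumes is $(1+2m/n)^d$, which tends to 1 as $n$ grows. *)
Lemma folner {R : realType} (d m : nat) (e : R) : 0 < e ->
  exists2 n, (0 < n)%N & ((n + m.*2) ^ d)%:R <= (1 + e) * (n ^ d)%:R.
Proof.
move=> e0.
have : (fun x : R => (1 + x) ^+ d) @ 0 --> ((1 + 0) ^+ d : R).
  apply: (@continuous_comp _ _ _ (fun x : R => 1 + x) (fun x => x ^+ d) 0);
    last exact: exprn_continuous.
  by apply: cvgD; [exact: cvg_cst|exact: cvg_id].
rewrite addr0 expr1n => /cvgrPdist_le /(_ _ e0) /nbhs_ballP[r /= r0 hr].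
(* [r] is a radius of continuity of $(1+x)^d$ at 0; [k] above $2m/r$ brings $2m/(k+1)$ below [r],
   and the successor keeps the side positive. *)
have [k hk] : exists k : nat, m.*2%:R / r < k%:R.
  exists (Num.truncn (m.*2%:R / r)).+1; exact: truncnS_gt.
exists k.+1 => //.
have k0 : 0 < k.+1%:R :> R by rewrite ltr0n.
have : `|1 - (1 + m.*2%:R / k.+1%:R) ^+ d| <= e.
  apply: hr; rewrite /ball /= sub0r normrN ger0_norm ?divr_ge0//.
  rewrite ltr_pdivrMr// mulrC -ltr_pdivrMr// (lt_trans hk)// ltr_nat.
  by [].
rewrite distrC => /(le_trans (ler_norm _)) h.
have -> : ((k.+1 + m.*2) ^ d)%:R =
    (1 + m.*2%:R / k.+1%:R) ^+ d * (k.+1 ^ d)%:R :> R.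
  rewrite !natrX -exprMn; congr (_ ^+ _).
  by rewrite mulrDl mul1r divfK ?gt_eqF// natrD.
by rewrite ler_wpM2r// -lerBlDl.
Qed.

(** * Differences of absolutely convergent sums *)

Section Esum.
Context {R : realType} {T : choiceType}.
Local Open Scope ereal_scope.

(** This is the form in which [hamiltonian] sums its terms. The majorant [w] makes all four sums
    finite, so that [fine] loses nothing, and [c] controls the termwise differences. *)
Lemma le_esum_pos_neg_dist (P : set T) (a b : T -> R) (c w : T -> \bar R) (D : R) :
    \esum_(x in P) w x < +oo ->
    (forall x, P x -> (`|a x|%:E <= w x) /\ (`|b x|%:E <= w x)) ->
    (forall x, P x -> `|(a x - b x)%R|%:E <= c x) -> \esum_(x in P) c x <= D%:E ->
  (`|fine (\esum_(x in P) (EFin \o a)^\+ x - \esum_(x in P) (EFin \o a)^\- x)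
  - fine (\esum_(x in P) (EFin \o b)^\+ x - \esum_(x in P) (EFin \o b)^\- x)|
  <= D)%R.
Proof.
move=> woo; wlog suff: a b / forall (a b : T -> R),
    (forall x, P x -> (`|a x|%:E <= w x) /\ (`|b x|%:E <= w x)) ->
    (forall x, P x -> `|(a x - b x)%R|%:E <= c x) -> \esum_(x in P) c x <= D%:E ->
  (fine (\esum_(x in P) (EFin \o a)^\+ x - \esum_(x in P) (EFin \o a)^\- x)
  - fine (\esum_(x in P) (EFin \o b)^\+ x - \esum_(x in P) (EFin \o b)^\- x)
  <= D)%R.
  move=> H abw abc contD; rewrite ler_norml lerNl opprB.
  by apply/andP; split; apply: H => // x Px; [case: (abw x Px)|
    rewrite distrC; exact: abc].
move=> {}a {}b abw abc contD.
have fp (f : T -> \bar R) : (forall x, P x -> 0 <= f x) ->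
    (forall x, P x -> f x <= w x) -> \esum_(x in P) f x \is a fin_num.
  move=> f0 fw; rewrite ge0_fin_numE ?esum_ge0//.
  by rewrite (le_lt_trans _ woo)// le_esum.
have fpos (v : T -> R) : (forall x, P x -> `|v x|%:E <= w x) ->
    \esum_(x in P) (EFin \o v)^\+ x \is a fin_num.
  move=> vw; apply: fp => x Px; first exact: funepos_ge0.
  apply: le_trans (vw x Px).
  by rewrite funeposE /= ge_max !lee_fin ler_norm normr_ge0.
have fneg (v : T -> R) : (forall x, P x -> `|v x|%:E <= w x) ->
    \esum_(x in P) (EFin \o v)^\- x \is a fin_num.
  move=> vw; apply: fp => x Px; first exact: funeneg_ge0.
  apply: le_trans (vw x Px).
  by rewrite funenegE /= ge_max !lee_fin -normrN ler_norm normr_ge0.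
have aw x Px := (abw x Px).1; have bw x Px := (abw x Px).2.
have ap := fpos a aw; have an := fneg a aw.
have bp := fpos b bw; have bn := fneg b bw.
(* With the negative parts moved across, all families are nonnegative and their sums add; termwise
   the claim is $a^+ + b^- \le a^- + b^+ + |a-b|$. *)
have : \esum_(x in P) (EFin \o a)^\+ x + \esum_(x in P) (EFin \o b)^\- x <=
    \esum_(x in P) (EFin \o a)^\- x + \esum_(x in P) (EFin \o b)^\+ x + D%:E.
  apply: le_trans (leeD2l _ contD).
  have c0 x : P x -> 0 <= c x.
    by move=> Px; apply: le_trans (abc x Px); rewrite lee_fin.
  rewrite -!esumD//;
    do ?by move=> x _; rewrite ?adde_ge0 ?funeneg_ge0 ?funepos_ge0.
  apply: le_esum => x Px; apply: le_trans (leeD2l _ (abc x Px)).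
  rewrite !funeposE !funenegE /= -!EFin_max -!EFinD lee_fin.
  have := ler_norm (a x - b x)%R.
  case: (leP (a x) 0%R); case: (leP (- a x)%R 0%R);
    by case: (leP (b x) 0%R); case: (leP (- b x)%R 0%R); lra.
rewrite -(fineK ap) -(fineK an) -(fineK bp) -(fineK bn) -!EFinB -!EFinD !lee_fin /=.
lra.
Qed.

End Esum.

(** * Boundary effects in the Hamiltonian and comparison of Gibbs measures *)

Section GibbsComparison.
Context {R : realType} {d : nat}.
Variable U : {fset site d} -> config d -> R.
Implicit Types (A L : {fset site d}) (i j : site d).
Local Open Scope ereal_scope.

Let w A := sup_abs (U A).

Lemma le_sup_abs (f : config d -> R) sigma : `|f sigma|%:E <= sup_abs f.
Proof. by apply: ereal_sup_ubound; exists sigma. Qed.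

Lemma sup_abs_ge0 (f : config d -> R) : 0 <= sup_abs f.
Proof. by apply: le_trans (le_sup_abs f (fun=> true)); rewrite lee_fin. Qed.

Definition translate i A : {fset site d} := [fset (j + i)%R | j in A]%fset.

Lemma mem_translate i A j : (j \in translate i A) = ((j - i)%R \in A).
Proof.
apply/imfsetP/idP => [[k kA ->]|jA]; first by rewrite addrK.
by exists (j - i)%R => //; rewrite subrK.
Qed.

Lemma sup_abs_translate i A : ti_potential U -> w (translate i A) = w A.
Proof.
move=> ti; rewrite /w /sup_abs; congr ereal_sup.
apply/seteqP; split=> _ [sigma _ <-] /=.
  by exists (shift i sigma) => //; rewrite ti.
exists (shift (- i)%R sigma) => //; rewrite ti.
congr (`|U A _|%:E); apply/funext => j.
by rewrite /shift addrA addNr add0r.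
Qed.

(** A set meeting [L] is counted on the right once for each site of its intersection with [L], hence
    at least once. *)
Lemma esum_meets_le L (c : {fset site d} -> \bar R) : (forall A, 0 <= c A) ->
  \esum_(A in [set A : {fset site d} | (A `&` L != fset0)%fset]) c A <=
  \sum_(i <- L) \esum_(A in [set A : {fset site d} | i \in A]) c A.
Proof.
move=> c0; set P := (X in esum X _).
apply: (@le_trans _ _
    (\esum_(A in P) \sum_(i <- L) (if i \in A then c A else 0))).
  apply: le_esum => A /= /fset0Pn[i]; rewrite inE => /andP[iA iL].
  rewrite (big_fsetD1 i)//= iA leeDl// sume_ge0// => j _.
  by case: ifP.
rewrite esum_sum => [|A i _ _]; last by case: ifP.
apply: lee_sum => i _; rewrite esum_mkcond [leRHS]esum_mkcond.
apply: le_esum => A _.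
have -> : (A \in [set A : {fset site d} | i \in A]) = (i \in A).
  by apply/idP/idP => [/set_mem|/mem_set].
by case: ifP => _; case: ifP.
Qed.

(** Bounds the change in the energy term of [A] when the spins off [L] change: none if [A] lies in
    [L], at most twice the supremum of $|U(A,\cdot)|$ otherwise. *)
Definition boundary_weight L A : \bar R := if (A `<=` L)%fset then 0 else w A + w A.

Lemma esum_reindex_translate i (c : {fset site d} -> \bar R) :
  \esum_(A in [set A : {fset site d} | i \in A]) c A =
  \esum_(A in [set A : {fset site d} | 0%R \in A]) c (translate i A).
Proof.
apply: reindex_esum; split.
- by move=> A /=; rewrite mem_translate subrr.
- move=> A B _ _ /fsetP AB; apply/fsetP => j.
  by have := AB (j + i)%R; rewrite !mem_translate addrK.
- move=> A /= iA; exists (translate (- i)%R A).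
    by rewrite /= mem_translate opprK add0r.
  by apply/fsetP => j; rewrite !mem_translate opprK subrK.
Qed.

(** A finite family carries the convergent sum up to [e], and finitely many finite sets fit into one
    cube. *)
Lemma tail_weight (e : R) : (0 < e)%R ->
    \esum_(A in [set A : {fset site d} | 0%R \in A]) w A < +oo ->
  exists m0, forall m, (m0 <= m)%N ->
    \esum_(A in [set A : {fset site d} | 0%R \in A])
      (if (A `<=` ball_cube m)%fset then 0 else w A) <= e%:E.
Proof.
move=> e0; set P := [set A : {fset site d} | _] => woo.
have wfin : \esum_(A in P) w A \is a fin_num.
  by rewrite ge0_fin_numE// esum_ge0// => A _; exact: sup_abs_ge0.
have [_ [X [finX XP] <-]] := ub_ereal_sup_adherent e0 wfin.
rewrite -/(esum P w) => hX.
have [m0 hm0] : exists m0, forall A, X A -> (A `<=` ball_cube m0)%fset.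
  exists (\max_(A : fset_set X) xchoose (sub_ball_cube (val A))).
  move=> A XA; have AX : A \in fset_set X by rewrite in_fset_set// mem_set.
  have := xchooseP (sub_ball_cube (val [`AX]%fset)) => /= h.
  apply: fsubset_trans h _; apply: le_ball_cube.
  exact: (@leq_bigmax (fset_set X) (fun B => xchoose (sub_ball_cube (val B)))
    [`AX]%fset).
exists m0 => m m0m; apply: (@le_trans _ _ (\esum_(A in P `&` ~` X) w A)).
  rewrite esum_mkcondr; apply: le_esum => A _.
  case: ifPn => [_|nA]; first by case: ifP => // _; exact: sup_abs_ge0.
  rewrite ifT// in_setC; apply: contra nA => /set_mem /hm0 /fsubset_trans; apply.
  exact: le_ball_cube.
(* The total splits into the part on [X], which exceeds the total minus [e], and the remainder,
   which is therefore below [e]. *)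
have := esumID X P w (fun A _ => sup_abs_ge0 (U A)).
rewrite (setIidr XP) (_ : \esum_(A in X) w A = \sum_(A \in X) w A); last first.
  have -> : esum X = esum [set` fset_set X] by rewrite fset_setK.
  rewrite esum_fset// => [|A _]; last exact: sup_abs_ge0.
  by rewrite fset_setK.
move: wfin hX; set S := \esum_(A in P) w A.
set Q := \sum_(A \in X) w A; set T := \esum_(A in _) _ => Sfin hX SE.
have Q0 : 0 <= Q by apply: fsume_ge0 => A _; exact: sup_abs_ge0.
have T0 : 0 <= T by apply: esum_ge0 => A _; exact: sup_abs_ge0.
have /andP[Qf Tf] : (Q \is a fin_num) && (T \is a fin_num).
  by rewrite -fin_numD -SE.
move: hX; rewrite SE -(fineK Qf) -(fineK Tf) -?EFinN -!EFinD lte_fin lee_fin.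
lra.
Qed.

Lemma boundary_weight_ge0 L A : 0 <= boundary_weight L A.
Proof.
by rewrite /boundary_weight; case: ifP => // _; rewrite adde_ge0// sup_abs_ge0.
Qed.

Lemma uas_bound : uas_potential U -> exists2 K : R, (0 <= K)%R &
  forall i, \esum_(A in [set A : {fset site d} | i \in A]) w A <= K%:E.
Proof.
case=> _; set E := [set _ | _ in _] => Eoo.
have Ei i : \esum_(A in [set A : {fset site d} | i \in A]) w A <= ereal_sup E.
  by apply: ereal_sup_ubound; exists i.
have E0 : 0 <= ereal_sup E.
  by apply: le_trans (Ei 0%R); apply: esum_ge0 => A _; exact: sup_abs_ge0.
by exists (fine (ereal_sup E)); rewrite ?fine_ge0// => i;
  rewrite fineK ?ge0_fin_numE.
Qed.

Lemma esum_dbl (P : set {fset site d}) (c : {fset site d} -> \bar R) (K : R) :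
  (forall A, 0 <= c A) ->
  \esum_(A in P) c A <= K%:E -> \esum_(A in P) (c A + c A) <= (2 * K)%:E.
Proof.
move=> c0 h; rewrite esumD//; apply: le_trans (leeD h h) _.
by rewrite -EFinD lee_fin; lra.
Qed.

(** Sum over the sites of the thickened cube. A set through a site of $[0,n)^d$ that leaves the
    thickened cube also leaves the copy of [ball_cube m] around that site, so only the tail [e]
    counts; each of the other $(n+2m)^d-n^d$ sites gets the crude bound [K]. The factor 2 is that of
    [boundary_weight]. *)
Lemma boundary_weight_small : uas_potential U -> ti_potential U ->
  exists2 K : R, (0 <= K)%R & forall e, (0 < e)%R -> exists m0, forall m n,
  (m0 <= m)%N ->
  \esum_(A in [set A : {fset site d} | (A `&` cube m (n + m.*2) != fset0)%fset])
     boundary_weight (cube m (n + m.*2)) A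
  <= (2 * (e * (n ^ d)%:R + K * (((n + m.*2) ^ d)%:R - (n ^ d)%:R)))%:E.
Proof.
move=> uas ti; have [K K0 hK] := uas_bound uas; exists K => // e e0.
have [m0 hm0] : exists m0, forall m, (m0 <= m)%N ->
    \esum_(A in [set A : {fset site d} | 0%R \in A])
      (if (A `<=` ball_cube m)%fset then 0 else w A) <= e%:E.
  by apply: tail_weight => //; rewrite (le_lt_trans (hK 0%R))// ltry.
exists m0 => m n m0m; set L := cube m _; have {}hm0 := hm0 m m0m.
apply: le_trans (esum_meets_le _ (@boundary_weight_ge0 L)) _.
have IL : (cube 0 n `<=` L)%fset.
  by apply/fsubsetP => i /cubeP h; apply/cubeP => c; have := h c; lia.
have Le i : i \in cube 0 n ->
    \esum_(A in [set A : {fset site d} | i \in A]) boundary_weight L A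
    <= (2 * e)%:E.
  (* Translation carries the site [i] to the origin, where the tail estimate holds. *)
  move=> iI; rewrite esum_reindex_translate.
  apply: le_trans (esum_dbl _ hm0); last first.
    by move=> A; case: ifP => // _; exact: sup_abs_ge0.
  apply: le_esum => A _; rewrite /boundary_weight.
  have [Am|nAm] := boolP (A `<=` ball_cube m)%fset; last first.
    by case: ifP => _; rewrite ?sup_abs_translate// adde_ge0// sup_abs_ge0.
  rewrite ifT ?adde0//; apply/fsubsetP => j; rewrite mem_translate => jA.
  rewrite -(subrKC i j) /L; apply: add_ball_cube => //.
  exact: (fsubsetP Am).
have LK i : \esum_(A in [set A : {fset site d} | i \in A]) boundary_weight L A
    <= (2 * K)%:E.
  apply: le_trans (esum_dbl (fun A => sup_abs_ge0 (U A)) (hK i)).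
  apply: le_esum => A _; rewrite /boundary_weight.
  by case: ifP => // _; rewrite adde_ge0// sup_abs_ge0.
rewrite (big_fsetID _ (mem (cube 0 n)))/=.
rewrite mulrDr EFinD leeD//.
- apply: (@le_trans _ _ (\sum_(i <- [fset x in L | x \in cube 0 n]%fset) (2 * e)%:E)).
    rewrite big_seq [leRHS]big_seq; apply: lee_sum => i.
    by rewrite !inE => /andP[_ /Le].
  rewrite sumEFin lee_fin.
  have -> : [fset x in L | x \in cube 0 n]%fset = cube 0 n.
    by apply/fsetP => i; rewrite !inE andb_idl//; exact: (fsubsetP IL).
  by rewrite big_const_seq count_predT iter_addr_0 card_cube mulrA mulr_natr.
- apply: (@le_trans _ _ (\sum_(i <- (L `\` cube 0 n)%fset) (2 * K)%:E)).
    have -> : [fset x in L | x \notin cube 0 n]%fset = (L `\` cube 0 n)%fset.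
      by apply/fsetP => i; rewrite !inE andbC.
    by apply: lee_sum => i _.
  rewrite sumEFin lee_fin big_const_seq count_predT iter_addr_0.
  rewrite cardfsD (fsetIidPr IL) !card_cube -natrB ?mulrA ?mulr_natr//.
  by have := fsubset_leq_card IL; rewrite !card_cube.
Qed.

Lemma hamiltonian_dist L (s : {ffun L -> bool}) eta eta' (D : R) :
    uas_potential U ->
    \esum_(A in [set A : {fset site d} | (A `&` L != fset0)%fset])
      boundary_weight L A <= D%:E ->
  (`|hamiltonian U eta s - hamiltonian U eta' s| <= D)%R.
Proof.
move=> uas hD; apply: (le_esum_pos_neg_dist (w := w) _ _ _ hD).
- have [K K0 hK] := uas_bound uas.
  apply: le_lt_trans (esum_meets_le _ (fun A => sup_abs_ge0 (U A))) _.
  apply: (@le_lt_trans _ _ (\sum_(i <- L) K%:E)).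
    by apply: lee_sum => i _; exact: hK.
  by rewrite sumEFin ltry.
- by move=> A _; split; exact: le_sup_abs.
- move=> A _; rewrite /boundary_weight; case: ifPn => AL.
    have -> : U A (glue s eta) = U A (glue s eta').
      case: uas => dep _; apply: dep => i iA.
      by rewrite /glue insubT//; exact: (fsubsetP AL).
    by rewrite subrr normr0.
  apply: le_trans (leeD (le_sup_abs _ (glue s eta)) (le_sup_abs _ (glue s eta'))).
  by rewrite -EFinD lee_fin ler_normB.
Qed.

Local Open Scope ring_scope.

(** The Boltzmann factor and the partition function each change by a factor of at most [expR D],
    hence [2 * D]. *)
Lemma finite_volume_gibbs_ratio L (s : {ffun L -> bool}) eta eta' (D : R) :
    (forall s : {ffun L -> bool}, `|hamiltonian U eta s - hamiltonian U eta' s| <= D) ->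
  finite_volume_gibbs U eta s <= expR (2 * D) * finite_volume_gibbs U eta' s.
Proof.
move=> hD; rewrite /finite_volume_gibbs.
have Z0 xi : 0 < @partition_function R d U L xi.
  rewrite /partition_function (bigD1 s)//= ltr_pwDl ?expR_gt0//.
  by apply: sumr_ge0 => s' _; exact: expR_ge0.
have h1 : expR (- hamiltonian U eta s) <= expR D * expR (- hamiltonian U eta' s).
  by rewrite -expRD ler_expR; have := hD s; rewrite ler_norml; lra.
have h2 : @partition_function R d U L eta' <= expR D * @partition_function R d U L eta.
  rewrite /partition_function mulr_sumr; apply: ler_sum => s' _.
  by rewrite -expRD ler_expR; have := hD s'; rewrite ler_norml; lra.
have h3 : 1 <= expR D * @partition_function R d U L eta /
    @partition_function R d U L eta' by rewrite ler_pdivlMr// mul1r.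
rewrite ler_pdivrMr//; apply: le_trans h1 _; apply: le_trans (ler_peMr _ h3) _.
  by rewrite mulr_ge0// expR_ge0.
have -> : expR (2 * D) = expR D * expR D by rewrite -expRD; congr expR; ring.
by rewrite le_eqVlt; apply/orP; left; apply/eqP; ring.
Qed.

(** The conditioning identity on the whole space makes the probability of the cylinder the mean of
    [g], which equals the finite-volume weight almost everywhere. *)
Lemma gibbs_cylinder_bounds mu L (s : {ffun L -> bool}) (lo hi : R) :
    is_gibbs U mu ->
    (forall eta, lo <= finite_volume_gibbs U eta s <= hi) ->
  lo <= fine (mu (cylinder s)) <= hi.
Proof.
move=> gmu h; have [g [_ ig mug] gae] := gmu L s.
have {mug} := mug setT (@measurableT _ (g_sigma_algebraType (outside_events L))).
rewrite setTI => mug.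
have lohi : lo <= hi by have /andP[] := h (fun=> true); exact: le_trans.
(* Clamping [g] to the interval from [lo] to [hi] changes it on a null set only and makes the bounds
   hold at every point. *)
pose g' x := Num.max lo (Num.min hi (g x)).
have mg : measurable_fun setT g.
  by apply/measurable_EFinP; exact: measurable_int ig.
have mg' : measurable_fun setT g'.
  by apply: measurable_maxr => //; exact: measurable_minr.
have g'b x : lo <= g' x <= hi.
  by rewrite /g' le_max lexx /= ge_max lohi ge_min lexx.
have E : (\int[mu]_x (g x)%:E = \int[mu]_x (g' x)%:E)%E.
  apply: ae_eq_integral => //; [exact/measurable_EFinP..|].
  apply: filterS gae => x gx _; congr EFin.
  rewrite /g' gx; have /andP[lx xh] := h x.
  by rewrite min_r// max_r.
have ig' : mu.-integrable setT (EFin \o g').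
  apply: measurable_bounded_integrable => //.
    by rewrite -ge0_fin_numE// fin_num_measure.
  exists (`|lo| + `|hi|); split; first exact: num_real.
  move=> x Mx y _; apply: le_trans (ltW Mx).
  by have := g'b y; rewrite ler_norml; move: (ler_norm hi) (ler_norm (- lo));
    rewrite normrN; have := normr_ge0 lo; have := normr_ge0 hi; lra.
have ic (r : R) : mu.-integrable setT (EFin \o cst r).
  by apply: continuous_integrable; exact: cst_continuous.
have Ic (r : R) : (\int[mu]_x (EFin \o cst r) x = r%:E)%E.
  by have := expectation_cst mu r; rewrite unlock.
have muf : mu (cylinder s) \is a fin_num.
  apply: fin_num_measure; apply: sub_sigma_algebra; exact: cylinder_open.
rewrite -!lee_fin fineK// -mug E -(Ic lo) -(Ic hi).
apply/andP; split; apply: le_integral => // x _ /=;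
  by rewrite lee_fin; have /andP[] := g'b x.
Qed.

(** Both measures give each cylinder a probability within a factor [expR (2 * D)] of the same
    reference weight, hence [4 * D]; a nonnegative local [f] is a nonnegative combination of
    cylinder indicators. *)
Lemma gibbs_comparison (mu nu : probability (config d) R) L (D : R)
    (f : config d -> R) :
    is_gibbs U mu -> is_gibbs U nu ->
    (forall (s : {ffun L -> bool}) eta eta',
      `|hamiltonian U eta s - hamiltonian U eta' s| <= D) ->
    depends_on L f -> (forall sigma, 0 <= f sigma) ->
  mean nu f <= expR (4 * D) * mean mu f.
Proof.
move=> gmu gnu hD fL f0; pose eta0 : config d := fun=> true.
rewrite !(mean_local _ eta0 fL) mulr_sumr; apply: ler_sum => s _.
rewrite mulrCA ler_wpM2l//.
pose p := finite_volume_gibbs U eta0 s.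
have r1 eta eta' := finite_volume_gibbs_ratio s (fun s => hD s eta eta').
have b eta : expR (- (2 * D)) * p <= finite_volume_gibbs U eta s <= expR (2 * D) * p.
  apply/andP; split; last exact: (r1 eta eta0).
  have := r1 eta0 eta; rewrite -/p => pb.
  by rewrite expRN mulrC ler_pdivrMr ?expR_gt0// mulrC.
have /andP[_ nub] := gibbs_cylinder_bounds gnu b.
have /andP[mub _] := gibbs_cylinder_bounds gmu b.
apply: le_trans nub _.
have -> : expR (2 * D) * p = expR (4 * D) * (expR (- (2 * D)) * p).
  by rewrite mulrA -expRD; congr (expR _ * _); ring.
by rewrite ler_pM2l ?expR_gt0.
Qed.

End GibbsComparison.

(** * Uniform convergence and closure; induction along the half-line *)

Section Uniform.
Context {R : realType} {d : nat}.
Implicit Types (f g : config d -> R).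

Lemma uniform_cvgP (F : set_system (config d -> R)) f : Filter F ->
  {uniform, F --> f} <->
  forall e, 0 < e -> \forall g \near F, forall sigma, `|f sigma - g sigma| < e.
Proof.
move=> FF; split=> [Ff e e0|Ff P /uniform_nbhs[E [/= + EP]]].
  apply: (Ff [set g | forall sigma, `|f sigma - g sigma| < e]).
  apply/uniform_nbhs; exists [set xy | `|xy.1 - xy.2| < e]; split.
    by rewrite -entourage_ballE; exists e.
  by move=> g /= h sigma; exact: h.
rewrite -entourage_ballE => -[e /= e0 eE].
by apply: filterS (Ff e e0) => g h; apply: EP => sigma _; apply: eE; exact: h.
Qed.

Lemma uniform_closureP (A : set ({uniform config d -> R} * {uniform config d -> R}))
    (f g : {uniform config d -> R}) :
  closure A (f, g) <->
  forall e, 0 < e -> exists f' g', [/\ A (f', g'),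
    forall sigma, `|f sigma - f' sigma| < e &
    forall sigma, `|g sigma - g' sigma| < e].
Proof.
split=> [cA e e0|h B].
  have nb (u : {uniform config d -> R}) :
      nbhs u [set v | forall sigma, `|u sigma - v sigma| < e].
    have /uniform_cvgP : {uniform, nbhs u --> u} by [].
    by apply.
  have /cA[[f' g'] [Afg [/= h1 h2]]] : nbhs (f, g)
      ([set v | forall sigma, `|f sigma - v sigma| < e] `*`
       [set v | forall sigma, `|g sigma - v sigma| < e]).
    by exists ([set v | forall sigma, `|f sigma - v sigma| < e],
      [set v | forall sigma, `|g sigma - v sigma| < e]) => //; split.
  by exists f', g'.
case=> -[P Q] [/= /uniform_nbhs[E1 [+ EP]] /uniform_nbhs[E2 [+ EQ]]] PQB.
rewrite -!entourage_ballE => -[e1 /= e10 eE1] [e2 /= e20 eE2].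
have [|f' [g' [Afg h1 h2]]] := h (Num.min e1 e2); first by rewrite lt_min e10.
exists (f', g'); split=> //; apply: PQB; split=> /=.
  apply: EP => sigma _; apply: eE1; apply: lt_le_trans (h1 sigma) _.
  by rewrite ge_min lexx.
apply: EQ => sigma _; apply: eE2; apply: lt_le_trans (h2 sigma) _.
by rewrite ge_min lexx orbT.
Qed.

End Uniform.

(** If [P] failed at some time, the times up to which [P] holds would have a supremum. The limit
    hypothesis gives [P] there, and the step hypothesis then goes beyond it. *)
Lemma real_induction {R : realType} (P : R -> Prop) :
    P 0 ->
    (forall t, 0 <= t -> P t -> exists2 r, 0 < r & forall h, 0 < h < r -> P (t + h)) ->
    (forall t, 0 < t -> (forall s, 0 <= s < t -> P s) -> P t) ->
  forall t, 0 <= t -> P t.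
Proof.
move=> P0 Pstep Plim t0 t00; apply: contrapT => nP.
pose A := [set s | 0 <= s /\ forall r, 0 <= r <= s -> P r].
have A0 : A 0.
  by split=> // r /andP[r0 r0']; rewrite (le_anti (introT andP (conj r0' r0))).
have At s : A s -> s <= t0.
  move=> [s0 h]; rewrite leNgt; apply/negP => ts.
  by apply: nP; apply: h; rewrite t00 ltW.
have supA : has_sup A by split; [exists 0|exists t0 => s /At].
have s0 : 0 <= sup A by apply: ub_le_sup => //; exists t0 => s /At.
have Plt r : 0 <= r < sup A -> P r.
  move=> /andP[r0 rs].
  have e0 : 0 < sup A - r by rewrite subr_gt0.
  have [s [_ h] rs'] := sup_adherent e0 supA.
  by apply: h; rewrite r0 /= ltW//; move: rs'; rewrite opprB addrC subrK.
have Ps : P (sup A).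
  move: s0; rewrite le_eqVlt => /orP[/eqP <-//|s0].
  exact: Plim.
have [r r0 hr] := Pstep _ s0 Ps.
have : A (sup A + r / 2).
  split=> [|u /andP[u0 us]]; first by rewrite addr_ge0// divr_ge0// ltW.
  have [us'|us'|->//] := ltgtP u (sup A); first by apply: Plt; rewrite u0.
  rewrite -(subrKC (sup A) u); apply: hr; rewrite subr_gt0 us' /=.
  by rewrite ltrBlDl (le_lt_trans us)// ltrD2l ltr_pdivrMr// ltr_pMr// ltr1n.
move=> Asr; have : sup A + r / 2 <= sup A.
  by apply: ub_le_sup => //; exists t0 => s /At.
by rewrite gerDl leNgt divr_gt0.
Qed.

(** * Feller semigroups: positivity, generator, commutation with translations *)

Section Semigroup.
Context {R : realType} {d : nat}.
Variable S : R -> (config d -> R) -> config d -> R.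
Hypothesis FS : feller_semigroup S.
Implicit Types (f g : config d -> R).

Lemma semigroup_cst t (a : R) : 0 <= t -> S t (fun=> a) = (fun=> a).
Proof.
move=> t0; have S0 : S t (fun=> 0) = (fun=> 0).
  have := feller_linear FS (-1) t0 (cont_cst 1) (cont_cst 1).
  by rewrite (feller_1 FS t0) mulr1 addNr.
have := feller_linear FS a t0 (cont_cst 1) (cont_cst 0).
by rewrite (feller_1 FS t0) S0 mulr1 addr0.
Qed.

Lemma semigroupD t f g : 0 <= t -> continuous f -> continuous g ->
  S t (fun s => f s + g s) = (fun s => S t f s + S t g s).
Proof.
move=> t0 cf cg; have := feller_linear FS 1 t0 cf cg.
by under eq_fun do rewrite mul1r; move=> ->; under eq_fun do rewrite mul1r.
Qed.

Lemma semigroupZ t (a : R) f : 0 <= t -> continuous f ->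
  S t (fun s => a * f s) = (fun s => a * S t f s).
Proof.
move=> t0 cf; have := feller_linear FS a t0 cf (cont_cst 0).
rewrite semigroup_cst//.
by under eq_fun do rewrite addr0; move=> ->; under eq_fun do rewrite addr0.
Qed.

Lemma semigroupB t f g : 0 <= t -> continuous f -> continuous g ->
  S t (fun s => f s - g s) = (fun s => S t f s - S t g s).
Proof.
move=> t0 cf cg; have := feller_linear FS (-1) t0 cg cf.
under eq_fun do rewrite mulN1r addrC.
by move=> ->; under eq_fun do rewrite mulN1r addrC.
Qed.

Lemma semigroup_sum t I (r : seq I) (F : I -> config d -> R) : 0 <= t ->
    (forall i, continuous (F i)) ->
  S t (fun s => \sum_(i <- r) F i s) = (fun s => \sum_(i <- r) S t (F i) s).
Proof.
move=> t0 cF; elim: r => [|i r IH].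
  under eq_fun do rewrite big_nil.
  by rewrite semigroup_cst//; apply/funext => s; rewrite big_nil.
under eq_fun do rewrite big_cons.
rewrite semigroupD//; last exact: continuous_config_sum.
by rewrite IH; apply/funext => s; rewrite big_cons.
Qed.

Lemma semigroup_le t f g : 0 <= t -> continuous f -> continuous g ->
  (forall s, f s <= g s) -> forall s, S t f s <= S t g s.
Proof.
move=> t0 cf cg fg s; rewrite -subr_ge0.
have := feller_ge0 FS t0 (contB cg cf) _ s; rewrite semigroupB//; apply.
by move=> s'; rewrite subr_ge0.
Qed.

Lemma semigroup_contract t f (M : R) : 0 <= t -> continuous f ->
  (forall s, `|f s| <= M) -> forall s, `|S t f s| <= M.
Proof.
move=> t0 cf fM s; rewrite ler_norml.
have h1 := semigroup_le t0 cf (cont_cst M) _ s.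
have h2 := semigroup_le t0 (cont_cst (- M)) cf _ s.
rewrite !semigroup_cst// in h1 h2; apply/andP; split.
  by apply: h2 => s'; have := fM s'; rewrite ler_norml => /andP[].
by apply: h1 => s'; have := fM s'; rewrite ler_norml => /andP[].
Qed.

(** Jensen's inequality for the positive linear functional sending [f] to [S t f s], which fixes
    constants: apply it to the tangent at [a]. *)
Lemma expR_semigroup t f s : 0 <= t -> continuous f ->
  expR (S t f s) <= S t (expR \o f) s.
Proof.
move=> t0 cf; set a := S t f s.
have cl : continuous (fun s => (1 - a) + f s) by apply: contD => //; exact: cont_cst.
have := semigroup_le t0 (contZ (expR a) cl) (continuous_expR_comp cf)
  (fun s => expR_tangent a (f s)) s.
rewrite semigroupZ// semigroupD ?semigroup_cst//; last exact: cont_cst.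
by rewrite -/a subrK mulr1.
Qed.

Local Notation gen := (infinitesimal_generator S).

Lemma generator_near f g (e : R) : gen (f, g) -> 0 < e ->
  exists2 r, 0 < r & forall h, 0 < h < r ->
    forall sigma, `|S h f sigma - f sigma - h * g sigma| <= e * h.
Proof.
move=> [cf cg /uniform_cvgP fg] e0.
have := fg e e0; rewrite near_map => -[r /= r0 hr].
exists r => // h /andP[h0 hh] sigma.
have /(_ sigma) : forall sigma, `|g sigma - h^-1 * (S h f sigma - f sigma)| < e.
  by apply: hr => //=; rewrite sub0r normrN gtr0_norm.
have -> : S h f sigma - f sigma - h * g sigma =
    h * - (g sigma - h^-1 * (S h f sigma - f sigma)).
  by field; rewrite gt_eqF.
by rewrite normrM normrN gtr0_norm// (mulrC e) ler_pM2l// => /ltW.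
Qed.

(** [S h] commutes with [S t], and the contraction [S t] preserves the uniform first-order expansion
    of [S h f]. *)
Lemma generator_semigroup t f g : 0 <= t -> gen (f, g) -> gen (S t f, S t g).
Proof.
move=> t0 fg; have [/= cf cg _] := fg.
split; [exact: feller_continuous FS _ _ t0 cf|exact: feller_continuous FS _ _ t0 cg|].
apply/uniform_cvgP => e e0; rewrite near_map.
have [r r0 hr] := generator_near fg (divr_gt0 e0 (ltr0n _ 2)).
exists r => // h /=; rewrite sub0r normrN => hh h0.
rewrite gtr0_norm// in hh; move=> sigma.
have h0' := ltW h0.
have h0r : 0 < h < r by rewrite h0.
have hr' := hr h h0r.
have cSf := feller_continuous FS h0' cf.
have -> : S h (S t f) = S t (S h f).
  by rewrite -!(feller_D FS)// addrC.
have := semigroup_contract t0 (contB (contB cSf cf) (contZ h cg)) hr' sigma.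
rewrite semigroupB ?semigroupB ?semigroupZ//; [|exact: contB|exact: contZ].
have -> : S t g sigma - h^-1 * (S t (S h f) sigma - S t f sigma) =
    h^-1 * - (S t (S h f) sigma - S t f sigma - h * S t g sigma).
  by field; rewrite gt_eqF.
rewrite normrM normrN gtr0_norm ?invr_gt0// => hA.
by rewrite mulrC ltr_pdivrMr// (le_lt_trans hA)// ltr_pM2r//; lra.
Qed.

(* Let [T] be the conjugate of [S] by the translation. For [f] in the domain,
   [S h - T h] is [o(h)] at [T u f], so that [v u := S u f - T u f] satisfies
   [|v (u + h)| <= |S h (v u)| + o(h) <= |v u| + o(h)]; as [v 0 = 0], [v] vanishes. *)
Lemma semigroup_shift i :
    (forall i f g, gen (f, g) -> gen (f \o shift i, g \o shift i)) ->
  forall t f g, 0 <= t -> gen (f, g) ->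
    S t (f \o shift i) = S t f \o shift i.
Proof.
move=> gsh t f g t0 fg.
have shK (h : config d -> R) j : (h \o shift j) \o shift (- j) = h.
  apply/funext => sigma /=; congr h; apply/funext => k.
  by rewrite /shift addrA addNr add0r.
pose T u (h : config d -> R) : config d -> R := S u (h \o shift i) \o shift (- i).
have [/= cf cg _] := fg.
have cT u : 0 <= u -> continuous (T u f).
  by move=> u0; exact/continuous_shift/(feller_continuous FS u0)/continuous_shift.
have cS u : 0 <= u -> continuous (S u f).
  by move=> u0; exact: (feller_continuous FS u0 cf).
have TK u : T u f \o shift i = S u (f \o shift i).
  by have := shK (S u (f \o shift i)) (- i); rewrite opprK.
(* The accumulated error grows with an arbitrarily small slope; the slope [e / (t + 1)] yields a
   bound by [e] at time [t], including [t = 0]. *)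
suff key e : 0 < e -> forall u, 0 <= u ->
    forall sigma, `|S u f sigma - T u f sigma| <= e * u.
  rewrite -[LHS]TK; congr (_ \o _); apply/funext => sigma; apply/eqP.
  rewrite eq_sym -subr_eq0 -normr_le0; apply/ler_addgt0Pl => e e0; rewrite addr0.
  have e0' : 0 < e / (t + 1) by rewrite divr_gt0// ltr_wpDl.
  apply: le_trans (key _ e0' t t0 sigma) _.
  rewrite mulrAC ler_pdivrMr ?ltr_wpDl// ler_pM2l//.
  by rewrite lerDl.
move=> e0; apply: real_induction.
- move=> sigma; rewrite /T !(feller_0 FS)//; last exact: continuous_shift.
  by rewrite shK subrr normr0 mulr0.
- move=> u u0 Pu.
  have gT : gen (T u f, T u g).
    by apply: (gsh); apply: generator_semigroup => //; exact: gsh.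
  have gTi := gsh i _ _ gT.
  (* At [T u f] both [S h] and its conjugate have first-order term [h * T u g], with error at most
     [e / 2 * h] each. *)
  have e20 : 0 < e / 2 by rewrite divr_gt0.
  have [r1 r10 h1] := generator_near gT e20.
  have [r2 r20 h2] := generator_near gTi e20.
  exists (Num.min r1 r2); first by rewrite lt_min r10.
  move=> h /andP[h0]; rewrite lt_min => /andP[hr1 hr2] sigma.
  have h0' := ltW h0.
  have h0r1 : 0 < h < r1 by rewrite h0.
  have h0r2 : 0 < h < r2 by rewrite h0.
  have H1 := h1 h h0r1 sigma; have H2 := h2 h h0r2 (shift (- i) sigma).
  have E1 : S (u + h) f = S h (S u f) by rewrite addrC (feller_D FS).
  have E2 : T (u + h) f = S h (T u f \o shift i) \o shift (- i).
    by rewrite TK /T addrC (feller_D FS)//; exact: continuous_shift.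
  have H3 : `|S h (S u f) sigma - S h (T u f) sigma| <= e * u.
    have := semigroup_contract h0' (contB (cS u u0) (cT u u0)) Pu sigma.
    by rewrite semigroupB//; [exact: cS|exact: cT].
  have shE (k : config d -> R) : (k \o shift i) (shift (- i) sigma) = k sigma.
    by have := congr1 (fun q => q sigma) (shK k i).
  rewrite !shE in H2.
  rewrite E1 E2 /=; move: H1 H2 H3.
  set a := S h (S u f) sigma; set b := S h (T u f) sigma.
  set q := S h _ _; set v := T u f sigma; set w := T u g sigma.
  by rewrite !ler_norml; lra.
(* At a limit time, step back by a small [h]: strong continuity at 0 lets [S u f] and [T u f] move
   by at most [e' / 2] each. *)
- move=> u u0 Pu sigma; apply/ler_addgt0Pl => e' e'0.
  have ce f' : continuous f' -> exists2 r, 0 < r & forall h, 0 < h < r ->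
      forall s, `|S h f' s - f' s| <= e' / 2.
    move=> cf'; have /uniform_cvgP := feller_strong FS cf'.
    move=> /(_ (e' / 2) (divr_gt0 e'0 (ltr0n _ 2))); rewrite near_map => -[r r0 hr].
    exists r => // h /andP[h0 hh] s; rewrite distrC; apply/ltW; apply: hr => //=.
    by rewrite sub0r normrN gtr0_norm.
  have [r1 r10 h1] := ce f cf.
  have [r2 r20 h2] := ce (f \o shift i) (continuous_shift (i := i) cf).
  pose h := Num.min (u / 2) (Num.min (r1 / 2) (r2 / 2)).
  have h0 : 0 < h by rewrite !lt_min !divr_gt0.
  have hu : h <= u / 2 by rewrite ge_min lexx.
  have hr1 : h < r1.
    by apply: (@le_lt_trans _ _ (r1 / 2)); rewrite ?ge_min ?lexx ?orbT//; lra.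
  have hr2 : h < r2.
    by apply: (@le_lt_trans _ _ (r2 / 2)); rewrite ?ge_min ?lexx ?orbT//; lra.
  have uh0 : 0 <= u - h by lra.
  have close f' : continuous f' -> (forall s, `|S h f' s - f' s| <= e' / 2) ->
      forall s, `|S u f' s - S (u - h) f' s| <= e' / 2.
    move=> cf' hf' s.
    have -> : S u f' = S (u - h) (S h f') by rewrite -(feller_D FS) ?subrK// ltW.
    have cSh := feller_continuous FS (ltW h0) cf'.
    have := semigroup_contract uh0 (contB cSh cf') hf' s.
    by rewrite semigroupB.
  have h0r1 : 0 < h < r1 by rewrite h0.
  have h0r2 : 0 < h < r2 by rewrite h0.
  have H1 := close f cf (h1 h h0r1) sigma.
  have H2 := close _ (continuous_shift (i := i) cf) (h2 h h0r2) (shift (- i) sigma).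
  have huu : 0 <= u - h < u by rewrite uh0 /=; lra.
  have := Pu (u - h) huu sigma.
  have : e * (u - h) <= e * u by rewrite ler_pM2l//; lra.
  rewrite /T /=; move: H1 H2.
  set a := S u f sigma; set b := S (u - h) f sigma.
  set a' := S u _ _; set b' := S (u - h) _ _.
  by rewrite !ler_norml; lra.
Qed.

End Semigroup.

(** * Translation invariance of the spin-flip dynamics *)

Section Translation.
Context {R : realType} {d : nat}.
Implicit Types (f g : config d -> R) (i j : site d).

Lemma shift_flip i j (sigma : config d) :
  shift i (flip j sigma) = flip (j - i) (shift i sigma).
Proof.
apply/funext => k; rewrite /shift /flip.
by rewrite [in RHS]eq_sym subr_eq addrC eq_sym.
Qed.

Lemma depends_on_shift {T : Type} (L L' : {fset site d}) i (f : config d -> T) :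
  depends_on L f -> (forall j, j \in L -> i + j \in L') ->
  depends_on L' (f \o shift i).
Proof.
by move=> fL LL' sigma eta h; apply: fL => j jL; apply: h; exact: LL'.
Qed.

(** A translated flip at [j] is a flip of the translate at [j - i]; reindexing accordingly,
    invariance of the rates matches the coefficients. *)
Lemma spin_flip_operator_shift (c : site d -> config d -> R) f i : ti_rates c ->
  spin_flip_operator c (f \o shift i) = spin_flip_operator c f \o shift i.
Proof.
move=> tic; apply/funext => sigma; rewrite /spin_flip_operator /=.
have bi : bijective (fun j : site d => j - i).
  by exists (fun j => j + i) => j; rewrite ?subrK ?addrK.
rewrite [RHS](reindex_fsbigT (fun j : site d => j - i) _ bi); apply: eq_fsbigr => j _.
rewrite shift_flip tic (tic (j - i)); congr (c 0 _ * _).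
by apply/funext => k; rewrite /shift addrA (addrC i) subrK.
Qed.

(** Translations preserve locality and uniform distances, so commutation with the operator passes to
    the closure. *)
Lemma spin_flip_generator_shift (c : site d -> config d -> R) i f g :
    ti_rates c -> spin_flip_generator c (f, g) ->
  spin_flip_generator c (f \o shift i, g \o shift i).
Proof.
move=> tic /uniform_closureP cA; apply/uniform_closureP => e e0.
have [f' [g' [/= [[L fL] ->] h1 h2]]] := cA e e0.
exists (f' \o shift i), (spin_flip_operator c f' \o shift i); split=> /=.
- split; last by rewrite spin_flip_operator_shift.
  exists (translate i L); apply: depends_on_shift fL _ => j jL.
  by rewrite mem_translate addrC addKr.
- by move=> sigma; exact: h1.
- by move=> sigma; exact: h2.
Qed.

Lemma spin_flip_semigroup_shift (c : site d -> config d -> R) S t f i :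
    ti_rates c -> spin_flip_semigroup c S -> 0 <= t -> is_local f ->
  S t (f \o shift i) = S t f \o shift i.
Proof.
move=> tic [FS genE] t0 fl.
apply: (@semigroup_shift _ _ _ FS i _ t f (spin_flip_operator c f)) => //.
  by move=> {}i f' g'; rewrite genE => /spin_flip_generator_shift; exact.
by rewrite genE; apply: subset_closure.
Qed.

End Translation.

(** * Oscillations of sums of translates *)

Section Concentration.
Context {R : realType} {d : nat}.
Implicit Types (f : config d -> R) (i j : site d) (L : {fset site d}).

Definition sum_shifts n f : config d -> R :=
  fun sigma => \sum_(i <- cube 0 n) f (shift i sigma).

Lemma sum_shifts_continuous n f : continuous f -> continuous (sum_shifts n f).
Proof.
by move=> cf; apply: continuous_config_sum => i; exact: continuous_shift.
Qed.

Lemma flip_depends_on L f j sigma : depends_on L f -> j \notin L ->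
  f (flip j sigma) = f sigma.
Proof.
move=> fL jL; apply: fL => i iL; rewrite /flip; case: eqP => // ij.
by rewrite -ij iL in jL.
Qed.

(** Only translates with [j - i] in [L] feel the spin at [j]; there are at most as many as sites in
    [L], and each changes by at most [2M]. *)
Lemma sum_shifts_flip L f (M : R) n j sigma :
    depends_on L f -> (forall sigma, `|f sigma| <= M) ->
  `|sum_shifts n f (flip j sigma) - sum_shifts n f sigma| <= M *+ 2 *+ #|` L|.
Proof.
move=> fL fM; have M0 : 0 <= M := le_trans (normr_ge0 _) (fM sigma).
rewrite /sum_shifts -sumrB (le_trans (ler_norm_sum _ _ _))//.
apply: (@le_trans _ _ (\sum_(i <- cube 0 n | j - i \in L) M *+ 2)).
  rewrite [leRHS]big_mkcond/=; apply: ler_sum => i _.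
  rewrite shift_flip; case: ifPn => ji.
    by rewrite (le_trans (ler_normB _ _))// mulr2n lerD.
  by rewrite (flip_depends_on _ fL ji) subrr normr0.
rewrite big_const_seq iter_addr_0 ler_wpMn2l ?mulrn_wge0//.
rewrite -size_filter -(size_map (fun i => j - i)).
apply: uniq_leq_size.
  rewrite map_inj_uniq ?filter_uniq ?fset_uniq// => x y.
  by move/addrI/oppr_inj.
by move=> x /mapP[i + ->]; rewrite mem_filter => /andP[].
Qed.

(** Only spins in the thickened cube matter, each with an oscillation bounded independently of [n];
    so the squared norm grows like the volume and not like its square. *)
Lemma oscillation_norm2_sum_shifts L f (M a : R) m n :
    depends_on L f -> (forall sigma, `|f sigma| <= M) ->
    (L `<=` ball_cube m)%fset -> 0 <= a ->
  (oscillation_norm2 (fun sigma => (a * sum_shifts n f sigma)%R) ^+ 2 <=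
   (((n + m.*2) ^ d)%:R * (a * (M *+ 2 *+ #|` L|)) ^+ 2)%:E)%E.
Proof.
move=> fL fM Lm a0; set K := M *+ 2 *+ #|` L|; set h := fun _ => _.
have M0 : 0 <= M := le_trans (normr_ge0 _) (fM (fun=> true)).
have K0 : 0 <= K by rewrite !mulrn_wge0.
have hj j sigma : `|h (flip j sigma) - h sigma| <=
    if j \in cube m (n + m.*2) then a * K else 0.
  rewrite -mulrBr normrM (ger0_norm a0); case: ifPn => jL.
    by rewrite ler_wpM2l// sum_shifts_flip.
  rewrite /sum_shifts -sumrB big_seq big1 ?normr0 ?mulr0// => i iI.
  rewrite shift_flip (flip_depends_on _ fL) ?subrr//.
  apply: contra jL => jiL; rewrite -(subrKC i j); apply: add_ball_cube => //.
  exact: (fsubsetP Lm).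
(* The oscillation has no absolute value, but flipping the same spin back reverses the increment, so
   one of the two increments is nonnegative. This allows the upper bounds to be squared. *)
have osc0 j : (0 <= oscillation j h)%E.
  pose s0 : config d := fun=> true.
  have [h0|h0] := leP 0 (h (flip j s0) - h s0).
    apply: (@le_trans _ _ (h (flip j s0) - h s0)%:E); first by rewrite lee_fin.
    by apply: ereal_sup_ubound; exists s0.
  apply: (@le_trans _ _ (h (flip j (flip j s0)) - h (flip j s0))%:E).
    have -> : flip j (flip j s0) = s0.
      by apply/funext => k; rewrite /flip; case: eqP => // _; rewrite negbK.
    by rewrite lee_fin; lra.
  by apply: ereal_sup_ubound; exists (flip j s0).
have oscK j : (oscillation j h <=
    (if j \in cube m (n + m.*2) then a * K else 0)%:E)%E.
  apply: ge_ereal_sup => _ [sigma _ <-]; rewrite lee_fin.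
  exact: le_trans (ler_norm _) (hj j sigma).
have sumK : (\esum_(j in [set: site d]) (oscillation j h ^+ 2) <=
    (((n + m.*2) ^ d)%:R * (a * K) ^+ 2)%:E)%E.
  apply: (@le_trans _ _ (\esum_(j in [set` cube m (n + m.*2)])
      (((a * K) ^+ 2)%:E : \bar R))%E).
    rewrite [leRHS]esum_mkcond; apply: le_esum => j _.
    have : (oscillation j h ^+ 2 <=
        (if j \in cube m (n + m.*2) then a * K else 0)%:E ^+ 2)%E.
      by rewrite !expe2 lee_pmul.
    have -> : (j \in [set` cube m (n + m.*2)]) = (j \in cube m (n + m.*2)).
      by apply/idP/idP => [/set_mem|/mem_set].
    by case: ifP => _ /le_trans; apply; rewrite -EFin_expe ?expr0n.
  rewrite esum_fset//; last by move=> j _; rewrite lee_fin sqr_ge0.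
  rewrite fsbig_finite//= set_fsetK sumEFin lee_fin.
  by rewrite big_const_seq count_predT iter_addr_0 card_cube mulr_natl.
rewrite /oscillation_norm2; move: sumK.
have : (0 <= \esum_(j in [set: site d]) (oscillation j h ^+ 2))%E.
  by apply: esum_ge0 => j _; rewrite expe_ge0.
case: (esum _ _) => [r| |]//; rewrite !lee_fin => r0 rK.
by rewrite -expr2 powR12_sqrt// sqr_sqrtr.
Qed.

End Concentration.

(** * Transfer of evolved expectations from one Gibbs measure to the other *)

Section Main.
Context {R : realType} {d : nat}.
Variable U : {fset site d} -> config d -> R.
Hypotheses (hU : uas_potential U) (hUti : ti_potential U).
Variables mup mum : probability (config d) R.
Hypotheses (hp : is_gibbs U mup) (hm : is_gibbs U mum).
Hypotheses (hpti : translation_invariant mup) (hmti : translation_invariant mum).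
Variable c : site d -> config d -> R.
Hypothesis hcti : ti_rates c.
Variable S : R -> (config d -> R) -> config d -> R.
Hypothesis hS : spin_flip_semigroup c S.
Variables (t : R) (mupt : probability (config d) R) (C : R).
Hypotheses (t0 : 0 <= t) (C0 : 0 < C).
Hypotheses (hmupt : evolves_to S t mup mupt) (hGCB : GCB mupt C).
Implicit Types f : config d -> R.

Let FS : feller_semigroup S := hS.1.

Lemma evolves_mean f : continuous f -> mean mupt f = mean mup (S t f).
Proof. by move=> cf; rewrite /mean hmupt. Qed.

(** The approximant freezes the spins outside a large cube to +1. *)
Lemma local_approximation f (e : R) : continuous f -> 0 < e ->
  exists n f', depends_on (ball_cube n) f' /\
    forall sigma, `|f sigma - f' sigma| < e.
Proof.
move=> cf e0.
have [n hn] := uniformly_local (@le_ball_cube d) (@ball_cube_cover d) cf e0.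
pose r (sigma : config d) := glue (restr (ball_cube n) sigma) (fun=> true).
exists n, (f \o r); split=> [sigma eta se|sigma] /=.
  congr f; congr (glue _ _); apply/ffunP => x.
  by rewrite !ffunE se// fsvalP.
by apply: hn => i iL; rewrite /r glue_agree.
Qed.

Lemma mean_sum_shifts mu n f : translation_invariant mu -> continuous f ->
  mean mu (sum_shifts n f) = (n ^ d)%:R * mean mu f.
Proof.
move=> ti cf; rewrite (@mean_sum _ _ mu _ (cube 0 n) (fun i => f \o shift i)).
  under eq_bigr do rewrite mean_shift//.
  by rewrite big_const_seq count_predT iter_addr_0 card_cube mulr_natl.
by move=> i; exact: continuous_shift.
Qed.

Lemma semigroup_sum_shifts n f : is_local f ->
  S t (sum_shifts n f) = sum_shifts n (S t f).
Proof.
move=> fl; have cf := local_continuous fl.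
rewrite (@semigroup_sum _ _ _ FS t _ (cube 0 n) (fun i => f \o shift i))//.
  apply/funext => sigma; apply: eq_bigr => i _.
  by rewrite (spin_flip_semigroup_shift i hcti hS).
by move=> i; exact: continuous_shift.
Qed.

Lemma depends_on_sum_shifts m n f : depends_on (ball_cube m) f ->
  depends_on (cube m (n + m.*2)) (sum_shifts n f).
Proof.
move=> fm sigma eta h; rewrite /sum_shifts big_seq [RHS]big_seq.
apply: eq_bigr => i iI.
by apply: (depends_on_shift fm _ h) => j jm; exact: add_ball_cube.
Qed.

(** The logarithm of the chain of exponential bounds at fixed [n] and [a]: [4 * D] is the price of
    exchanging the Gibbs measures, the term in [C] comes from concentration, and [2 * e] from
    passing from [S t f] to [f'] and back. *)
Lemma finite_volume_inequality f f' L m n (M a e D : R) :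
    depends_on L f -> (forall sigma, `|f sigma| <= M) ->
    (L `<=` ball_cube m)%fset -> 0 <= a ->
    depends_on (ball_cube m) f' -> (forall sigma, `|S t f sigma - f' sigma| <= e) ->
    (forall (s : {ffun cube m (n + m.*2) -> bool}) eta eta',
      `|hamiltonian U eta s - hamiltonian U eta' s| <= D) ->
  a * (n ^ d)%:R * (mean mum (S t f) - mean mupt f - 2 * e) <=
  4 * D + C * (((n + m.*2) ^ d)%:R * (a * (M *+ 2 *+ #|` L|)) ^+ 2).
Proof.
move=> fL fM Lm a0 f'm hf' hD; set N := (n ^ d)%:R : R.
have fl : is_local f by exists L.
have cf : continuous f := local_continuous fl.
have cf' : continuous f' := depends_on_continuous f'm.
have cphi : continuous (S t f) := feller_continuous FS t0 cf.
have e0 : 0 <= e := le_trans (normr_ge0 _) (hf' (fun=> true)).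
pose h sigma := a * sum_shifts n f sigma.
have ch : continuous h by apply: contZ; exact: sum_shifts_continuous.
have mh : mean mupt h = a * (N * mean mupt f).
  rewrite meanZ; last exact: sum_shifts_continuous.
  rewrite !evolves_mean//; last exact: sum_shifts_continuous.
  by rewrite semigroup_sum_shifts// mean_sum_shifts.
pose h0 sigma := h sigma - a * (N * mean mupt f).
have ch0 : continuous h0 by apply: contB => //; exact: cont_cst.
have upper : mean mupt (expR \o h0) <=
    expR (C * (((n + m.*2) ^ d)%:R * (a * (M *+ 2 *+ #|` L|)) ^+ 2)).
  have := hGCB ch; rewrite -/(mean mupt h) mh -/(expR \o h0).
  rewrite (meanE _ (continuous_expR_comp ch0)) -lee_fin => /le_trans; apply.
  rewrite -[leRHS]/(expeR _%:E) lee_expeR EFinM lee_pmul2l ?lte_fin//.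
  exact: oscillation_norm2_sum_shifts.
(* [G] depends only on the thickened cube, as the comparison of Gibbs measures requires; subtracting
   [a * N * e] places it below [S t h0]. *)
pose G sigma := a * sum_shifts n f' sigma - (a * N * e + a * (N * mean mupt f)).
have cG : continuous G.
  by apply: contB; [apply: contZ; exact: sum_shifts_continuous|exact: cont_cst].
have Gh sigma : G sigma <= S t h0 sigma.
  rewrite /h0 semigroupB//; [|exact: cont_cst]; rewrite semigroup_cst//.
  rewrite /h semigroupZ//; last exact: sum_shifts_continuous.
  rewrite semigroup_sum_shifts// /G opprD addrA lerB// lerBlDr -mulrA -mulrDr.
  rewrite ler_wpM2l// /sum_shifts -lerBlDl -sumrB.
  apply: (@le_trans _ _ (\sum_(i <- cube 0 n) e)).
    apply: ler_sum => i _; have := hf' (shift i sigma).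
    by rewrite ler_norml; lra.
  by rewrite big_const_seq count_predT iter_addr_0 card_cube /N mulr_natl.
have G1 : mean mup (expR \o G) <= mean mupt (expR \o h0).
  rewrite (evolves_mean (continuous_expR_comp ch0)).
  apply: le_mean; first exact: continuous_expR_comp.
    by apply: (feller_continuous FS t0 _); exact: continuous_expR_comp.
  move=> sigma; apply: le_trans (expR_semigroup FS sigma t0 ch0).
  by rewrite /= ler_expR.
have G2 : mean mum (expR \o G) <= expR (4 * D) * mean mup (expR \o G).
  apply: (gibbs_comparison hp hm hD) => [sigma eta se|sigma]; last exact: expR_ge0.
  by rewrite /= /G (depends_on_sum_shifts f'm se).
have G3 : mean mum G = a * (N * mean mum f') - (a * N * e + a * (N * mean mupt f)).
  rewrite /G (meanD _ (contZ a (@sum_shifts_continuous _ _ n f' cf'))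
    (cont_cst (- (a * N * e + a * (N * mean mupt f))))).
  by rewrite mean_cst meanZ ?mean_sum_shifts//; exact: sum_shifts_continuous.
have f'phi : mean mum (S t f) - e <= mean mum f'.
  rewrite lerBlDr -(mean_cst mum e) -meanD//; last exact: cont_cst.
  apply: le_mean => //; first by apply: contD => //; exact: cont_cst.
  by move=> sigma; have := hf' sigma; rewrite ler_norml; lra.
have : expR (mean mum G) <= expR (4 * D +
    C * (((n + m.*2) ^ d)%:R * (a * (M *+ 2 *+ #|` L|)) ^+ 2)).
  rewrite expRD; apply: le_trans (le_expR_mean mum cG) _.
  apply: le_trans G2 _; rewrite ler_pM2l ?expR_gt0//.
  exact: le_trans G1 upper.
rewrite ler_expR; apply: le_trans; rewrite G3.
have N0 : 0 <= a * N by rewrite mulr_ge0.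
have := ler_wpM2l N0 f'phi; lra.
Qed.

(** A positive gap [x] would give a gain [a * N * x], linear in [a], against a concentration cost
    quadratic in [a] and a boundary cost that is small relative to [N]. *)
Lemma mean_semigroup_le f : is_local f -> mean mum (S t f) <= mean mupt f.
Proof.
move=> fl; rewrite leNgt -subr_gt0; apply/negP.
set x := mean mum (S t f) - mean mupt f => x0.
have cf : continuous f := local_continuous fl.
have cphi : continuous (S t f) := feller_continuous FS t0 cf.
have [L fL] := fl; have [M M0 fM] := continuous_bounded cf.
pose K := M *+ 2 *+ #|` L|.
have K0 : 0 <= K by rewrite !mulrn_wge0.
have [B B0 hB] := boundary_weight_small hU hUti.
have CK0 : 0 < C * K ^+ 2 + 1 by rewrite ltr_wpDl// mulr_ge0 ?sqr_ge0// ltW.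
(* Chosen so that [a * (C * K ^+ 2)] is at most [x / 8]; the 1 in the denominator keeps it
   positive. *)
pose a := x / (8 * (C * K ^+ 2 + 1)).
have a0 : 0 < a by rewrite divr_gt0// mulr_gt0.
have aK : a * (C * K ^+ 2) <= x / 8.
  have -> : a * (C * K ^+ 2) = x / 8 * (C * K ^+ 2 / (C * K ^+ 2 + 1)).
    by rewrite /a; move: CK0; move: (C * K ^+ 2) => p p0; field; rewrite gt_eqF.
  apply: ler_piMr; first by rewrite divr_ge0// ltW.
  by rewrite ler_pdivrMr// mul1r lerDl.
(* [e] and [e1] bound the two parts of the boundary cost by [N * (a * x / 64)] each, and [4 * D] is
   8 times their sum. The cap 1 on [e1] keeps the thickened volume within [2 * N]. *)
pose e := a * x / 64; have e0 : 0 < e by exact: divr_gt0 (mulr_gt0 a0 x0) _.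
pose e1 := Num.min 1 (a * x / (64 * (B + 1))).
have B10 : 0 < B + 1 by rewrite ltr_wpDl.
have e10 : 0 < e1.
  by rewrite lt_min ltr01 (divr_gt0 (mulr_gt0 a0 x0))// mulr_gt0.
have e11 : e1 <= 1 by rewrite ge_min lexx.
have Be1 : B * e1 <= a * x / 64.
  apply: (@le_trans _ _ ((B + 1) * (a * x / (64 * (B + 1))))).
    apply: ler_pM => //; [exact: ltW|by rewrite lerDl|by rewrite ge_min lexx orbT].
  by rewrite le_eqVlt; apply/orP; left; apply/eqP; field; rewrite gt_eqF.
have x80 : 0 < x / 8 by rewrite divr_gt0.
have [n1 [f' [f'n1 hf']]] := local_approximation cphi x80.
have [m0 hm0] := hB e e0; have [mL hmL] := sub_ball_cube L.
(* [m] covers the potential tail, the support of the approximant and that of [f]; only then is [n]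
   taken large. *)
pose m := maxn m0 (maxn n1 mL).
have [n n0 hn] := folner d m e10.
have hD := hm0 m n (leq_maxl _ _).
set N := (n ^ d)%:R : R.
have N0 : 0 < N by rewrite ltr0n expn_gt0 n0.
have f'm : depends_on (ball_cube m) f'.
  move=> s eta se; apply: f'n1 => i ii; apply: se; move: i ii; apply/fsubsetP.
  by apply: le_ball_cube; rewrite /m !leq_max leqnn orbT.
have Lm : (L `<=` ball_cube m)%fset.
  by apply: fsubset_trans hmL _; apply: le_ball_cube; rewrite /m !leq_max leqnn !orbT.
have := finite_volume_inequality fL fM Lm (ltW a0) f'm
  (fun s => ltW (hf' s)) (fun s eta eta' => hamiltonian_dist s eta eta' hU hD).
rewrite -/K -/N -/x => H.
have V2 : ((n + m.*2) ^ d)%:R <= 2 * N.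
  apply: le_trans hn _; rewrite ler_pM2r//; lra.
have H1 : C * (((n + m.*2) ^ d)%:R * (a * K) ^+ 2) <= N * (a * (x / 4)).
  have -> : C * (((n + m.*2) ^ d)%:R * (a * K) ^+ 2) =
      a * (a * (C * K ^+ 2)) * ((n + m.*2) ^ d)%:R by ring.
  have -> : N * (a * (x / 4)) = a * (x / 8) * (2 * N) by field.
  apply: ler_pM => //; last by rewrite ler_pM2l.
  by apply: mulr_ge0 (ltW a0) (mulr_ge0 (ltW a0) (mulr_ge0 (ltW C0) (sqr_ge0 K))).
have H2 : 4 * (2 * (e * N + B * (((n + m.*2) ^ d)%:R - N))) <= N * (a * (x / 4)).
  have : B * (((n + m.*2) ^ d)%:R - N) <= N * (a * x / 64).
    apply: (@le_trans _ _ (B * (e1 * N))).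
      by rewrite ler_wpM2l// lerBlDr (le_trans hn)//; lra.
    by rewrite [leLHS]mulrA [leRHS]mulrC ler_pM2r.
  by rewrite /e; lra.
(* The gain keeps three quarters of [a * N * x] after the approximation error, while the two costs
   take at most one quarter each. *)
have : a * N * (x - 2 * (x / 8)) = N * (a * (x * (3 / 4))) by field.
have := mulr_gt0 N0 (mulr_gt0 a0 x0).
by lra.
Qed.

(** The inequality for the negative of a local function gives its reverse; uniform density of local
    functions and contractivity of [S t] then extend the equality to continuous [f]. *)
Lemma mean_semigroup f : continuous f -> mean mum (S t f) = mean mupt f.
Proof.
have leq g : is_local g -> mean mum (S t g) = mean mupt g.
  move=> gl; have cg := local_continuous gl.
  have cSg : continuous (S t g) := feller_continuous FS t0 cg.
  apply/eqP; rewrite eq_le mean_semigroup_le//=.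
  have := @mean_semigroup_le (fun s => -1 * g s); rewrite semigroupZ// !meanZ//.
  rewrite !mulN1r lerN2; apply; have [L gL] := gl.
  by exists L => s eta /gL ->.
move=> cf; apply/eqP; rewrite -subr_eq0 -normr_le0; apply/ler_addgt0Pl => e e0.
rewrite addr0.
have [n [f' [f'n hf']]] := local_approximation cf (divr_gt0 e0 (ltr0n R 2)).
have cf' : continuous f' := depends_on_continuous f'n.
have mle (mu : probability (config d) R) g g' : continuous g -> continuous g' ->
    (forall s, g s <= g' s + e / 2) -> mean mu g <= mean mu g' + e / 2.
  move=> cg cg' gg'; rewrite -[in leRHS](mean_cst mu (e / 2)) -meanD//.
    by apply: le_mean => //; apply: contD => //; exact: cont_cst.
  exact: cont_cst.
have mB (mu : probability (config d) R) g g' : continuous g -> continuous g' ->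
    (forall s, `|g s - g' s| <= e / 2) -> `|mean mu g - mean mu g'| <= e / 2.
  move=> cg cg' gg'; rewrite ler_norml lerBlDl lerNl opprB lerBlDl.
  by apply/andP; split; apply: mle => // s; have := gg' s; rewrite ler_norml; lra.
have H1 := mB mupt f f' cf cf' (fun s => ltW (hf' s)).
have H2 : `|mean mum (S t f) - mean mum (S t f')| <= e / 2.
  apply: mB; [exact: (feller_continuous FS t0 cf)|
              exact: (feller_continuous FS t0 cf')|].
  have := semigroup_contract FS t0 (contB cf cf') (fun s => ltW (hf' s)).
  by rewrite semigroupB.
have f'l : is_local f' by exists (ball_cube n).
have := leq f' f'l; move: H1 H2; rewrite !ler_norml; lra.
Qed.

Lemma evolves_to_other : evolves_to S t mum mupt.
Proof.
move=> f cf; rewrite !meanE ?mean_semigroup//.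
exact: (feller_continuous FS t0 cf).
Qed.

End Main.

Theorem theorem4p1 (R : realType) (d : nat) (hd : (0 < d)%N)
  (U : {fset site d} -> config d -> R)
  (hU : uas_potential U) (hUti : ti_potential U)
  (mup mum : probability (config d) R)
  (hne : ~ same_measure mup mum)
  (hp : is_gibbs U mup) (hm : is_gibbs U mum)
  (hpti : translation_invariant mup) (hmti : translation_invariant mum)
  (c : site d -> config d -> R) (hA : condition_A c) (hcti : ti_rates c)
  (S : R -> (config d -> R) -> config d -> R)
  (hS : spin_flip_semigroup c S) (hnd : nondegenerate_semigroup S)
  (t : R) (ht : 0 < t)
  (mupt : probability (config d) R) (hmupt : evolves_to S t mup mupt)
  (C : R) (hC : 0 < C) :
  ~ GCB mupt C.
Proof.
move=> hGCB; have hmumt := evolves_to_other hU hUti hp hm hpti hmti hcti hS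
  (ltW ht) hC hmupt hGCB.
exact: (hnd _ _ hne _ ht _ _ hmupt hmumt).
Qed.
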